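(* Let $X=\mathrm{Road}(\mathrm{Pad}(\mathrm{In}_\omega))$. Then $X$ is a branchwise-real tree order which is $\mathfrak{c}^+$-wispy. Hence, under the Continuum Hypothesis, there is an $\aleph_2$-wispy branchwise-real tree order with no continuous grading.
   Context: A tree order is a partial order with a minimum element such that for every $x$ the set $\{y\mid y\le x\}$ is linearly ordered; a branch is a maximal linearly ordered subset. A branchwise-real tree order is a tree order in which every branch is order-isomorphic to a real interval and any two elements have a greatest lower bound. A continuous grading is a strictly monotonic $\ell\colon X\to\mathbb{R}$ whose restriction to each $[x,y]=\{z\mid x\le z\le y\}$ ($x<y$) is an order-isomorphism onto $[\ell(x),\ell(y)]$. A well-stratified tree is a tree order in which each $\{y\mid y\le x\}$ is well-ordered; the rank of $x$ is the order type of $\{y\mid y<x\}$ and $T(\alpha)$ is the set of rank-$\alpha$ elements. $\mathrm{In}_\omega$ is the set of all injective functions $f\colon\alpha\to\omega$, $\alpha$ an ordinal, ordered by inclusion. For a well-stratified tree $T$, $\mathrm{Pad}(T)$ is obtained by adding, for each node $x$ of $T$ lying on level $0$ or on a limit level, a new node $x^-$ with $x^-<x$ and $y<x^-$ for all $y<x$ in $T$ (and no other new comparabilities). $\mathrm{Road}(T)$ is the suborder of the lexicographic product $T\times(0,1]$ consisting of the pairs $\langle x,t\rangle$ with $t=1$ or $x\in T(\alpha+1)$ for some ordinal $\alpha$. For $x$ in a tree order, the $x$-connected components are the equivalence classes of $\{y\mid y>x\}$ under $y\sim_x z$ iff there is $w>x$ with $w\le y,z$; $x$ is branching if there is more than one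 class. A twig is a maximal upwards-closed subset order-isomorphic to a non-trivial real interval. For a cardinal $\kappa$, the order is $\kappa$-wispy if it has fewer than $\kappa$ branching nodes and fewer than $\kappa$ twigs. $\mathfrak{c}=2^{\aleph_0}$. *)

(* Defs.v *)
From HB Require Import structures.
From mathcomp Require Import all_boot all_order all_algebra.
From mathcomp Require Import all_classical wochoice all_reals normedtype.

Set Implicit Arguments.
Unset Strict Implicit.
Unset Printing Implicit Defensive.
Import Order.TTheory GRing.Theory Num.Theory.
Local Open Scope classical_set_scope.
Local Open Scope card_scope.
Local Open Scope order_scope.

Definition order_iso (T U : Type) (r : rel T) (A : set T) (s : rel U) (B : set U)
    : Prop :=
  exists2 f : T -> U,
    set_bij A B f & {in A &, {mono f : x y / r x y >-> s x y}}.

(* [ordtype B] is the set of all ordinals of cardinality at most that of [B].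
   Such an ordinal is represented as an order type, that is, as the isomorphism
   class of some well-ordered subset (A, r) of [B]; the values of [r] outside
   [A] are irrelevant. *)
Definition ordtype (B : Type) : Type :=
  {C : set (set B * rel B) |
    exists (A : set B) (r : rel B),
      wo_chain r [in A] /\ C = [set p | order_iso r A p.2 p.1]}.

Definition has_ordtype (B : Type) (r : rel B) (A : set B) (a : ordtype B) : Prop :=
  sval a (A, r).

Definition ordtype_lt (B : Type) (a b : ordtype B) : Prop :=
  exists (r : rel B) (A : set B) (s : rel B) (A' : set B),
    [/\ has_ordtype r A a, has_ordtype s A' b &
        exists2 x, A' x &
          order_iso r A s [set y | [/\ A' y, s y x & y <> x]]].

Definition ordtype_zero (B : Type) (a : ordtype B) : Prop :=
  forall b, ~ ordtype_lt b a.

(* b = a + 1 *)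
Definition ordtype_succ (B : Type) (a b : ordtype B) : Prop :=
  ordtype_lt a b /\ forall c, ordtype_lt a c -> b = c \/ ordtype_lt b c.

Definition ordtype_limit (B : Type) (b : ordtype B) : Prop :=
  ~ ordtype_zero b /\ forall a, ~ ordtype_succ a b.

(* A cardinal is given by any type of that cardinality. *)
Definition card_lt (T U : Type) (A : set T) (B : set U) : Prop :=
  A #<= B /\ ~ (B #<= A).

(* The successor cardinal is the Hartogs number: the set of all ordinals of
   cardinality at most that of [K]. *)
Definition card_succ (K : Type) : Type := ordtype K.

Fixpoint aleph (n : nat) : Type :=
  if n is m.+1 then card_succ (aleph m) else nat.

Definition continuum : Type := nat -> bool.

Definition CH : Prop := [set: continuum] #= [set: aleph 1].

Section Trees.
Context (R : realType) (d : Order.disp_t) (T : porderType d).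
Implicit Types (A B C : set T) (x y z : T).

Definition lin_ordered A : Prop := total_on A (fun x y => x <= y).

Definition tree_order : Prop :=
  (exists m : T, forall x, m <= x) /\ forall x, lin_ordered [set y | y <= x].

Definition branch B : Prop :=
  lin_ordered B /\ forall C, lin_ordered C -> B `<=` C -> C = B.

Definition iso_interval A (I : set R) : Prop :=
  is_interval I /\ order_iso <=%O A <=%O I.

Definition branchwise_real : Prop :=
  [/\ tree_order,
      forall B, branch B -> exists I, iso_interval B I &
      forall x y, infimums [set x; y] !=set0].

Definition continuous_grading (l : T -> R) : Prop :=
  {homo l : x y / x < y} /\
  forall x y, x < y ->
    set_bij [set` `[x, y]] [set` `[l x, l y]] l /\
    {in [set` `[x, y]] &, {mono l : u v / u <= v}}.

Definition connected_above x y z : Prop :=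
  exists w, [/\ x < w, w <= y & w <= z].

Definition component x C : Prop :=
  exists2 y, x < y & C = [set z | x < z /\ connected_above x y z].

Definition branching x : Prop :=
  exists C C', [/\ component x C, component x C' & C <> C'].

Definition upwards_closed A : Prop := forall x y, A x -> x <= y -> A y.

Definition pretwig A : Prop :=
  upwards_closed A /\
  exists I : set R, iso_interval A I /\ exists s t, [/\ I s, I t & s != t].

Definition twig A : Prop :=
  pretwig A /\ forall C, pretwig C -> A `<=` C -> C = A.

Definition wispy (K : Type) : Prop :=
  card_lt [set x | branching x] [set: K] /\
  card_lt [set A | twig A] [set: K].

(* T(a), for a an ordinal. The rank of [x] is the order type of a subset of
   [T], so every rank belongs to [ordtype T]. *)
Definition level (a : ordtype T) : set T :=
  [set x | has_ordtype <=%O [set y | y < x] a].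

Definition on_zero_or_limit_level x : Prop :=
  exists2 a, level a x & ordtype_zero a \/ ordtype_limit a.

Definition on_successor_level x : Prop :=
  exists a b, ordtype_succ a b /\ level b x.

End Trees.

(* An ordinal admitting an injection into omega is countable, hence belongs to
   [ordtype nat]. Functions are identified with their graphs. *)
Definition injective_function (f : set (ordtype nat * nat)) : Prop :=
  [/\ exists a, forall b, (exists n, f (b, n)) <-> ordtype_lt b a,
      forall b m n, f (b, m) -> f (b, n) -> m = n &
      forall b c n, f (b, n) -> f (c, n) -> b = c].

Record In_omega : Type := InOmega {
  graph : set (ordtype nat * nat);
  _ : `[< injective_function graph >]
}.

HB.instance Definition _ := [isSub for graph].
HB.instance Definition _ := [Choice of In_omega by <:].
HB.instance Definition _ :=
  [SubChoice_isSubPOrder of In_omega by <: with set_display].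

Section Pad.
Context (d : Order.disp_t) (T : porderType d).

(* [Minus x] is the new node x^- just below [x]. *)
Inductive pad : Type :=
  | Node of T
  | Minus of {x : T | `[< on_zero_or_limit_level x >]}.

HB.instance Definition _ := gen_eqMixin pad.
HB.instance Definition _ := gen_choiceMixin pad.

Definition pad_le (u v : pad) : bool :=
  match u, v with
  | Node x, Node y => x <= y
  | Node y, Minus x => y < val x
  | Minus x, Node y => val x <= y
  | Minus x, Minus y => val x <= val y
  end.

Lemma pad_le_refl : reflexive pad_le.
Proof. by case=> [x|x] /=. Qed.

Lemma pad_le_anti : antisymmetric pad_le.
Proof.
case=> [x|x] [y|y] //=.
- by move/le_anti ->.
- by case/andP => /lt_le_trans h /h; rewrite ltxx.
- by case/andP => /le_lt_trans h /h; rewrite ltxx.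
- by move/le_anti/val_inj ->.
Qed.

Lemma pad_le_trans : transitive pad_le.
Proof.
case=> [y|y] [x|x] [z|z] //=.
- exact: le_trans.
- exact: le_lt_trans.
- exact: le_trans.
- by move=> h1 h2; apply: ltW (le_lt_trans h1 h2).
- by move=> h1 h2; apply: ltW (lt_le_trans h1 h2).
- exact: lt_le_trans.
- exact: le_trans.
- exact: le_trans.
Qed.

HB.instance Definition _ :=
  Order.Le_isPOrder.Build d pad pad_le_refl pad_le_anti pad_le_trans.

End Pad.

Section Road.
Context (R : realType) (d : Order.disp_t) (T : porderType d).

Definition in_road : pred (T *lexi[d] R) := fun p =>
  (0 < p.2 <= 1)%R && ((p.2 == 1%R) || `[< on_successor_level p.1 >]).

Record road : Type := RoadPoint {
  road_val : T *lexi[d] R;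
  _ : in_road road_val
}.

HB.instance Definition _ := [isSub for road_val].
HB.instance Definition _ := [Choice of road by <:].
HB.instance Definition _ := [SubChoice_isSubPOrder of road by <: with d].

End Road.

(* Main.v *)
(* An injective function into omega has countable length, so by Hartogs' theorem
   every downward closed injective partial function lies in [In_omega]. Hence a
   branch of the road consists of the points at or below a single node [F], and
   it is order-isomorphic to a real interval: the n-th value of [F] contributes
   a step of length 2^-(n+1), so a node [g] below [F] sits at height
   [sum_(n in range g) 2^-(n+1)], which is continuous at limit nodes.
   There are at most continuum many points; a twig is determined by any one of
   its points, which gives wispiness.
   A strictly monotone map from the road to the reals would yield rationals
   [q f], strictly increasing in [f], between the heights of two points lying
   over [Node f]. Enumerating the rationals, the recursion
   [f b := q (f restricted below b)] would then define an injection from all the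
   countable ordinals into omega. *)
Require Import Defs.
From mathcomp Require Import all_boot all_order all_algebra.
From mathcomp Require Import all_classical wochoice all_reals.

Set Implicit Arguments.
Unset Strict Implicit.
Unset Printing Implicit Defensive.
Import Order.TTheory GRing.Theory Num.Theory.
Local Open Scope classical_set_scope.
Local Open Scope card_scope.
Local Open Scope order_scope.

(** * Well-orders *)

Section WellOrders.
Context {T : Type}.
Implicit Types (r s : rel T) (A D S : set T).

(** [wo_chain] demands a unique minimum in every nonempty subset. If [x] and [y] precede each other,
    both are minima of the pair, so uniqueness gives antisymmetry. *)
Lemma wo_chainP r A : wo_chain r [in A] <->
  (forall x y, A x -> A y -> r x y -> r y x -> x = y) /\
  (forall S, S `<=` A -> S !=set0 -> exists2 m, S m & forall x, S x -> r m x).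
Proof.
split=> [h|[anti h]].
  split=> [x y Ax Ay rxy ryx|S SA [x Sx]].
    have /h[] : sub_mem (mem [in [set x; y]]) (mem [in A]).
      by move=> z /set_mem[->|->]; apply/mem_set.
    - by exists x; apply/mem_set; left.
    move=> m [[mxy lbm] um].
    have rr z : [set x; y] z -> r z z.
      move=> zxy.
      have /h[] : sub_mem (mem [in [set z]]) (mem [in A]).
        by move=> _ /set_mem->; apply/mem_set; case: zxy => ->.
      - by exists z; apply/mem_set.
      by move=> w [[/set_mem-> lbw] _]; apply: lbw; apply/mem_set.
    rewrite -(um x) ?(um y) //.
    - split; first by apply/mem_set; right.
      by move=> z /set_mem[->|->] //; apply: rr; right.
    - split; first by apply/mem_set; left.
      by move=> z /set_mem[->|->] //; apply: rr; left.
  have /h[] : sub_mem (mem [in S]) (mem [in A]).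
    by move=> z /set_mem /SA /mem_set.
  - by exists x; apply/mem_set.
  move=> m [[/set_mem Sm lbm] _]; exists m => // y Sy.
  by apply: lbm; apply/mem_set.
apply: (@antisymmetric_wo_chain _ _ [in A]).
  by move=> x y /set_mem Ax /set_mem Ay /andP[]; apply: anti.
move=> S SA [x Sx].
have [||m Sm lbm] := h [set` S].
- by move=> y /= /SA /set_mem.
- by exists x.
- by exists m; split.
Qed.

Section Theory.
Context {r : rel T} {A : set T} (woA : wo_chain r [in A]).

Lemma wo_anti x y : A x -> A y -> r x y -> r y x -> x = y.
Proof. by have [h _] := (wo_chainP r A).1 woA; apply: h. Qed.

Lemma wo_min S : S `<=` A -> S !=set0 ->
  exists2 m, S m & forall x, S x -> r m x.
Proof. by have [_ h] := (wo_chainP r A).1 woA; apply: h. Qed.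

Lemma wo_total x y : A x -> A y -> r x y \/ r y x.
Proof.
move=> Ax Ay; have [||m [->|->] h] := @wo_min [set x; y].
- by move=> _ [|] ->.
- by exists x; left.
- by left; apply: h; right.
- by right; apply: h; left.
Qed.

Lemma wo_refl x : A x -> r x x.
Proof. by move=> Ax; have [] := wo_total Ax Ax. Qed.

(** Minima also yield transitivity: if the least of the three points is [y] or [z], antisymmetry
    merges it with the point before it. *)
Lemma wo_trans y x z : A x -> A y -> A z -> r x y -> r y z -> r x z.
Proof.
move=> Ax Ay Az rxy ryz.
have [||m [[->|->]|->] h] := @wo_min [set x; y; z].
- by move=> _ [[|]|] ->.
- by exists x; left; left.
- by apply: h; right.
- have ryx : r y x by apply: h; left; left.
  by rewrite (wo_anti Ax Ay rxy ryx).
- have rzy : r z y by apply: h; left; right.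
  by rewrite -(wo_anti Ay Az ryz rzy).
Qed.

Lemma wo_sub D : D `<=` A -> wo_chain r [in D].
Proof.
move=> DA; apply/wo_chainP; split=> [x y /DA Ax /DA Ay|S /(_ _ _)/DA SD].
  exact: wo_anti.
exact: wo_min.
Qed.

End Theory.

Definition segment r A x : set T := [set y | [/\ A y, r y x & y <> x]].

Lemma segment_sub r A x : segment r A x `<=` A.
Proof. by move=> y []. Qed.

Lemma segment_segment r A x y : wo_chain r [in A] -> A x -> segment r A x y ->
  segment r (segment r A x) y = segment r A y.
Proof.
move=> woA Ax [Ay ryx yx]; apply/seteqP; split=> z [].
  by move=> [Az _ _] ? ?; split.
move=> Az rzy zy; split=> //; split=> //; first exact: (wo_trans woA Az Ay Ax).
by move=> zx; subst z; apply: yx; apply: (wo_anti woA).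
Qed.

(** If [D] misses a point of [A], the least missing point cuts it off. *)
Lemma downclosed_segment r A D : wo_chain r [in A] -> D `<=` A ->
  (forall x y, D y -> A x -> r x y -> D x) ->
  D = A \/ exists2 x, A x & D = segment r A x.
Proof.
move=> woA DA down; have [/subsetP AD|] := pselect (A `<=` D).
  by left; apply/seteqP; split=> // x Ax; apply/set_mem/AD/mem_set.
move=> /existsNP[x /not_implyP[Ax nDx]]; right.
have [||m [Am nDm] h] := wo_min woA (S := A `\` D); first by move=> ? [].
  by exists x.
exists m => //; apply/seteqP; split=> y.
  move=> Dy; split; first exact: DA.
    have [//|rmy] := wo_total woA (DA _ Dy) Am.
    by case: nDm; apply: (down m y).
  by move=> ym; subst y.
move=> [Ay rym ym]; apply: contrapT => nDy.
by apply: ym; apply: (wo_anti woA) => //; apply: h.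
Qed.

End WellOrders.

(** * Order isomorphisms between subsets *)

Lemma order_isoP (T U : Type) (r : rel T) A (s : rel U) B :
  order_iso r A s B <-> exists f : T -> U,
    [/\ forall x, A x -> B (f x),
        forall y, B y -> exists2 x, A x & f x = y,
        forall x y, A x -> A y -> f x = f y -> x = y &
        forall x y, A x -> A y -> s (f x) (f y) = r x y].
Proof.
split=> [[f [fAB finj fsurj] fmono]|[f [fAB fsurj finj fmono]]]; exists f.
- split=> //.
  + by move=> x y Ax Ay; apply: finj; apply/mem_set.
  + by move=> x y Ax Ay; apply: fmono; apply/mem_set.
- by split=> // x y /set_mem Ax /set_mem Ay; apply: finj.
- by move=> x y /set_mem Ax /set_mem Ay; apply: fmono.
Qed.

Lemma order_iso_refl (T : Type) (r : rel T) A : order_iso r A r A.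
Proof. by apply/order_isoP; exists id; split=> // y; exists y. Qed.

Lemma order_iso_trans (T U V : Type) (r : rel T) A (s : rel U) B (t : rel V) C :
  order_iso r A s B -> order_iso s B t C -> order_iso r A t C.
Proof.
move=> /order_isoP[f [f1 f2 f3 f4]] /order_isoP[g [g1 g2 g3 g4]].
apply/order_isoP; exists (g \o f); split=> /=.
- by move=> x /f1/g1.
- by move=> z /g2[y /f2[x Ax <-] <-]; exists x.
- by move=> x y Ax Ay /g3 h; apply: f3 => //; apply: h; apply: f1.
- by move=> x y Ax Ay; rewrite g4 ?f4 //; apply: f1.
Qed.

Lemma order_iso_sym (T : Type) (r : rel T) A (s : rel T) B :
  order_iso r A s B -> order_iso s B r A.
Proof.
move=> /order_isoP[f [f1 f2 f3 f4]].
(* Outside [B] the inverse takes the dummy value [y] itself, which is why both sets live in one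
   type. *)
have /choice[g gP] : forall y, exists x, B y -> A x /\ f x = y.
  move=> y; have [/f2[x Ax <-]|] := pselect (B y); first by exists x.
  by exists y.
apply/order_isoP; exists g; split.
- by move=> y /gP[].
- move=> x Ax; exists (f x); first exact: f1.
  by have [Ag fg] := gP _ (f1 _ Ax); apply: f3.
- by move=> x y /gP[_ gx] /gP[_ gy] gxy; rewrite -gx -gy gxy.
- by move=> x y /gP[Ax gx] /gP[Ay gy]; rewrite -f4 // gx gy.
Qed.

Lemma order_iso_wo (T U : Type) (r : rel T) A (s : rel U) B :
  order_iso r A s B -> wo_chain r [in A] -> wo_chain s [in B].
Proof.
move=> /order_isoP[f [f1 f2 f3 f4]] woA; apply/wo_chainP; split.
  move=> _ _ /f2[x Ax <-] /f2[y Ay <-]; rewrite !f4 // => rxy ryx.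
  by rewrite (wo_anti woA Ax Ay).
move=> S SB [_ /[dup]/SB/f2[x Ax <-] Sx].
have [||m [Am Sm] h] := wo_min woA (S := A `&` f @^-1` S); first by move=> ? [].
  by exists x.
exists (f m) => // _ /[dup]/SB/f2[y Ay <-] Sy.
by rewrite f4 //; apply: h.
Qed.

(** The isomorphism is passed as an explicit function because the conclusion names the image point
    [f x]. *)
Lemma order_iso_segment (T U : Type) (r : rel T) A (s : rel U) B f :
  [/\ forall x, A x -> B (f x),
      forall y, B y -> exists2 x, A x & f x = y,
      forall x y, A x -> A y -> f x = f y -> x = y &
      forall x y, A x -> A y -> s (f x) (f y) = r x y] ->
  forall x, A x -> order_iso r (segment r A x) s (segment s B (f x)).
Proof.
move=> [f1 f2 f3 f4] x Ax; apply/order_isoP; exists f; split.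
- move=> y [Ay ryx yx]; split; [exact: f1|by rewrite f4|].
  by move=> fyx; apply: yx; apply: f3.
- move=> _ [/f2[y Ay <-]]; rewrite f4 // => ryx fyx; exists y => //; split=> //.
  by move=> yx; apply: fyx; rewrite yx.
- by move=> y z [Ay _ _] [Az _ _]; apply: f3.
- by move=> y z [Ay _ _] [Az _ _]; apply: f4.
Qed.

(** * Comparability of well-orders *)

Section Comparison.
Context {T : Type}.
Implicit Types (r s : rel T) (A B : set T).

(** Take the least [m] that [f] moves strictly down. By monotonicity [f] also moves [f m] strictly
    down, and [f m] is smaller than [m]. *)
Lemma wo_not_iso_segment r A x : wo_chain r [in A] -> A x ->
  ~ order_iso r A r (segment r A x).
Proof.
move=> woA Ax /order_isoP[f [f1 f2 f3 f4]].
have fA y : A y -> A (f y) by move=> /f1[].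
have [||m [Am nm] h] := wo_min woA (S := [set y | A y /\ ~ r y (f y)]).
- by move=> ? [].
- exists x; split=> //; have [Afx rfx fx] := f1 _ Ax.
  by move=> rxf; apply: fx; apply: (wo_anti woA).
have [//|rfm] := wo_total woA Am (fA _ Am).
have [rff|nff] := pselect (r (f m) (f (f m))).
  by apply: nm; rewrite -f4 //; exact: fA.
by apply: nm; apply: h; split => //; exact: fA.
Qed.

(** Otherwise the larger segment would be isomorphic to a proper initial segment of itself. *)
Lemma wo_segment_inj r A x y : wo_chain r [in A] -> A x -> A y ->
  order_iso r (segment r A x) r (segment r A y) -> x = y.
Proof.
move=> woA.
wlog rxy : x y / r x y.
  move=> wl Ax Ay xy; have [rxy|ryx] := wo_total woA Ax Ay; first exact: wl.
  by apply/esym; apply: wl => //; apply: order_iso_sym.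
move=> Ax Ay xy; apply: contrapT => nxy.
have sx : segment r A y x by [].
apply: (@wo_not_iso_segment r (segment r A y) x) => //.
  exact: (wo_sub woA (@segment_sub _ _ _ _)).
by rewrite (segment_segment woA) //; apply: order_iso_sym.
Qed.

Lemma order_iso_segment_lt r s A B x y z :
  wo_chain r [in A] -> wo_chain s [in B] -> A x -> B y ->
  order_iso r (segment r A x) s (segment s B y) -> segment r A x z ->
  exists2 w, segment s B y w & order_iso r (segment r A z) s (segment s B w).
Proof.
move=> woA woB Ax By /order_isoP[f fP] xz; have [f1 _ _ _] := fP.
exists (f z); first exact: f1.
have := order_iso_segment fP xz.
by rewrite (segment_segment woA) // (segment_segment woB) //; apply: f1.
Qed.

Lemma wo_compare r s A B : wo_chain r [in A] -> wo_chain s [in B] ->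
  [\/ order_iso r A s B,
      exists2 y, B y & order_iso r A s (segment s B y) |
      exists2 x, A x & order_iso s B r (segment r A x)].
Proof.
move=> woA woB.
(* [M] matches points with isomorphic segments. It is an isomorphism between its domain [D] and its
   range [E], both downward closed. *)
pose M x y := [/\ A x, B y & order_iso r (segment r A x) s (segment s B y)].
have Mdown x y z : M x y -> segment r A x z ->
    exists2 w, segment s B y w & M z w.
  move=> [Ax By xy] xz.
  have [w yw zw] := order_iso_segment_lt woA woB Ax By xy xz.
  by exists w => //; split=> //; [case: xz|case: yw].
have Mdown' x y w : M x y -> segment s B y w ->
    exists2 z, segment r A x z & M z w.
  move=> [Ax By /order_iso_sym xy] yw.
  have [z xz /order_iso_sym wz] := order_iso_segment_lt woB woA By Ax xy yw.
  by exists z => //; split=> //; [case: xz|case: yw].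
have Mfun x y y' : M x y -> M x y' -> y = y'.
  move=> [_ By xy] [_ By' xy']; apply: (wo_segment_inj woB) => //.
  exact: order_iso_trans (order_iso_sym xy) xy'.
have Minj x x' y : M x y -> M x' y -> x = x'.
  move=> [Ax _ xy] [Ax' _ xy']; apply: (wo_segment_inj woA) => //.
  exact: order_iso_trans xy (order_iso_sym xy').
have Mmono x y x' y' : M x y -> M x' y' -> s y y' = r x x'.
  move=> Mxy Mxy'; have [Ax By _] := Mxy; have [Ax' By' _] := Mxy'.
  apply/idP/idP => [syy|rxx].
    have [yy|ny] := pselect (y = y').
      by subst y'; rewrite (Minj _ _ _ Mxy Mxy'); apply: (wo_refl woA).
    have [//|z [_ rz _] Mzy] := Mdown' _ _ y Mxy'.
    by rewrite (Minj _ _ _ Mxy Mzy).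
  have [xx|nx] := pselect (x = x').
    by subst x'; rewrite (Mfun _ _ _ Mxy Mxy'); apply: (wo_refl woB).
  have [//|z [_ rz _] Mzy] := Mdown _ _ x Mxy'.
  by rewrite (Mfun _ _ _ Mxy Mzy).
pose D := [set x | exists y, M x y]; pose E := [set y | exists x, M x y].
have /choice[f fP] : forall x, exists y, D x -> M x y.
  by move=> x; have [[y Mxy]|] := pselect (D x); [exists y|exists x].
have DE : order_iso r D s E.
  apply/order_isoP; exists f; split.
  - by move=> x /fP Mx; exists x.
  - move=> y [x Mxy]; have Dx : D x by exists y.
    by exists x => //; apply: Mfun Mxy; apply: fP.
  - move=> x x' /fP Mx /fP Mx' ff; apply: Minj Mx _.
    by rewrite ff.
  - by move=> x x' /fP Mx /fP Mx'; apply: Mmono.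
have DA : D `<=` A by move=> x [y []].
have EB : E `<=` B by move=> x [y []].
have Ddown x y : D y -> A x -> r x y -> D x.
  move=> [z Myz] Ax rxy; have [->|nxy] := pselect (x = y); first by exists z.
  by have [//|w _ Mw] := Mdown _ _ x Myz; exists w.
have Edown x y : E y -> B x -> s x y -> E x.
  move=> [z Myz] Ax rxy; have [->|nxy] := pselect (x = y); first by exists z.
  by have [//|w _ Mw] := Mdown' _ _ x Myz; exists w.
have [DeA|[x Ax Dx]] := downclosed_segment woA DA Ddown.
  have [EeB|[y By Ey]] := downclosed_segment woB EB Edown.
    by constructor 1; rewrite -DeA -EeB.
  by constructor 2; exists y => //; rewrite -DeA -Ey.
have [EeB|[y By Ey]] := downclosed_segment woB EB Edown.
  by constructor 3; exists x => //; rewrite -EeB -Dx; apply: order_iso_sym.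
(* If both [D] and [E] are proper, the two points cutting them off match each other, so [x] lies in
   its own segment. *)
have : D x by exists y; split=> //; rewrite -Dx -Ey.
by rewrite Dx => -[].
Qed.

End Comparison.

(** * Ordinals and Hartogs' theorem *)

Section OrdinalTypes.
Context {B : Type}.
Implicit Types (r s : rel B) (A D : set B) (a b c : ordtype B).

Lemma has_ordtype_exists r A : wo_chain r [in A] ->
  exists a, has_ordtype r A a.
Proof.
move=> woA; pose C := [set p : set B * rel B | order_iso r A p.2 p.1].
have h : exists (A0 : set B) (r0 : rel B), wo_chain r0 [in A0] /\
    C = [set p | order_iso r0 A0 p.2 p.1] by exists A, r.
by unshelve eexists; [exists C|apply: order_iso_refl].
Qed.

Lemma has_ordtype_rep a : exists r A, has_ordtype r A a.
Proof.
have [A [r [_ e]]] := svalP a; exists r, A; rewrite /has_ordtype e.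
exact: order_iso_refl.
Qed.

Lemma has_ordtype_wo r A a : has_ordtype r A a -> wo_chain r [in A].
Proof.
by have [A0 [r0 [wo0 e]]] := svalP a; rewrite /has_ordtype e => /order_iso_wo; apply.
Qed.

Lemma has_ordtype_iso r A s D a :
  has_ordtype r A a -> has_ordtype s D a -> order_iso r A s D.
Proof.
have [A0 [r0 [_ e]]] := svalP a; rewrite /has_ordtype e => /order_iso_sym h.
exact: order_iso_trans.
Qed.

Lemma iso_has_ordtype r A s D a :
  has_ordtype r A a -> order_iso r A s D -> has_ordtype s D a.
Proof.
have [A0 [r0 [_ e]]] := svalP a; rewrite /has_ordtype e; exact: order_iso_trans.
Qed.

Lemma has_ordtype_inj r A a b :
  has_ordtype r A a -> has_ordtype r A b -> a = b.
Proof.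
move=> ha hb; apply: eq_sig_hprop => [?|]; first exact: Prop_irrelevance.
move: ha hb; rewrite /has_ordtype.
have [A0 [r0 [_ ->]]] := svalP a; have [A1 [r1 [_ ->]]] := svalP b => /= h h1.
apply/seteqP; split=> p /= hp.
  exact: order_iso_trans (order_iso_trans h1 (order_iso_sym h)) hp.
exact: order_iso_trans (order_iso_trans h (order_iso_sym h1)) hp.
Qed.

(** [ordtype_lt] lets its representatives vary; moving the cut point along an isomorphism allows one
    fixed representative of [b]. *)
Lemma ordtype_ltP s D a b : has_ordtype s D b ->
  ordtype_lt a b <-> exists2 x, D x & has_ordtype s (segment s D x) a.
Proof.
move=> hb; split=> [[r [A [t [E [ha hE [x Ex hx]]]]]]|[x Dx hx]]; last first.
  exists s, (segment s D x), s, D; split=> //; exists x => //.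
  exact: order_iso_refl.
have /order_isoP[f fP] := has_ordtype_iso hE hb.
exists (f x); first by have [h _ _ _] := fP; apply: h.
apply: iso_has_ordtype ha _; apply: order_iso_trans hx _.
exact: order_iso_segment.
Qed.

Lemma ordtype_lt_irrefl a : ~ ordtype_lt a a.
Proof.
have [r [A ha]] := has_ordtype_rep a => /(ordtype_ltP _ ha)[x Ax hx].
apply: (wo_not_iso_segment (has_ordtype_wo ha) Ax).
exact: has_ordtype_iso ha hx.
Qed.

Lemma ordtype_lt_trans b a c :
  ordtype_lt a b -> ordtype_lt b c -> ordtype_lt a c.
Proof.
have [r [A hc]] := has_ordtype_rep c => ab /(ordtype_ltP _ hc)[x Ax hb].
apply/(ordtype_ltP _ hc); have [y xy ha] := (ordtype_ltP _ hb).1 ab.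
exists y; first by case: xy.
by rewrite -(segment_segment (has_ordtype_wo hc) Ax xy).
Qed.

Lemma ordtype_total a b : [\/ a = b, ordtype_lt a b | ordtype_lt b a].
Proof.
have [r [A ha]] := has_ordtype_rep a; have [s [D hb]] := has_ordtype_rep b.
have [h|[y Dy h]|[x Ax h]] := wo_compare (has_ordtype_wo ha) (has_ordtype_wo hb).
- by constructor 1; apply: has_ordtype_inj hb; apply: iso_has_ordtype h.
- constructor 2; apply/(ordtype_ltP _ hb); exists y => //.
  exact: iso_has_ordtype h.
- constructor 3; apply/(ordtype_ltP _ ha); exists x => //.
  exact: iso_has_ordtype h.
Qed.

Definition ordtype_le a b : bool := `[< a = b \/ ordtype_lt a b >].

Lemma ordtype_leP a b : ordtype_le a b <-> ~ ordtype_lt b a.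
Proof.
split=> [/asboolP[->|ab ba]|ba]; first exact: ordtype_lt_irrefl.
  by apply: (@ordtype_lt_irrefl a); apply: ordtype_lt_trans ba.
by apply/asboolP; have [| |//] := ordtype_total a b; [left|right].
Qed.

Lemma ordtype_le_anti a b : ordtype_le a b -> ordtype_le b a -> a = b.
Proof. by move=> /asboolP[//|ab] /ordtype_leP. Qed.

Lemma ordtype_ltW a b : ordtype_lt a b -> ordtype_le a b.
Proof. by move=> ab; apply/asboolP; right. Qed.

Lemma ordtype_le_lt_trans b a c :
  ordtype_le a b -> ordtype_lt b c -> ordtype_lt a c.
Proof. by move=> /asboolP[->//|]; apply: ordtype_lt_trans. Qed.

Lemma ordtype_lt_le_trans b a c :
  ordtype_lt a b -> ordtype_le b c -> ordtype_lt a c.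
Proof. by move=> + /asboolP[<-//|]; apply: ordtype_lt_trans. Qed.

(** All ordinals below some [a] in [S] are types of segments of one representative of [a], whose
    well-order supplies the minimum. *)
Lemma ordtype_min (S : set (ordtype B)) : S !=set0 ->
  exists2 a, S a & forall b, S b -> ordtype_le a b.
Proof.
move=> [a Sa]; have [r [A ha]] := has_ordtype_rep a.
have woA := has_ordtype_wo ha.
have [h|/existsNP[c /not_implyP[Sc /ordtype_leP/contrapT/(ordtype_ltP _ ha)[z Az hz]]]] :=
  pselect (forall b, S b -> ordtype_le a b); first by exists a.
pose Z := [set x | A x /\ exists2 b, S b & has_ordtype r (segment r A x) b].
have [||m [Am [b Sb hb]] mmin] := wo_min woA (S := Z); first by move=> ? [].
  by exists z; split=> //; exists c.
exists b => // d Sd; apply/ordtype_leP => db.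
have [y my hy] := (ordtype_ltP _ hb).1 db; have [Ay rym ym] := my.
apply: ym; apply: (wo_anti woA) => //; apply: mmin; split=> //; exists d => //.
by rewrite -(segment_segment woA Am my).
Qed.

Lemma ordtype_ind (P : ordtype B -> Prop) :
  (forall a, (forall b, ordtype_lt b a -> P b) -> P a) -> forall a, P a.
Proof.
move=> ih a; apply: contrapT => nPa.
have [b nPb bmin] := @ordtype_min [set b | ~ P b] (ex_intro _ a nPa).
apply: nPb; apply: ih => c cb; apply: contrapT => nPc.
by have /ordtype_leP := bmin _ nPc; apply.
Qed.

Lemma segment_ordtype_iso r A (woA : wo_chain r [in A]) :
  exists2 f : B -> ordtype B,
    forall x, A x -> has_ordtype r (segment r A x) (f x) &
    forall x y, A x -> A y -> ordtype_le (f x) (f y) = r x y.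
Proof.
have /choice[f fP] : forall x, exists a, A x -> has_ordtype r (segment r A x) a.
  move=> x.
  have [a ha] := has_ordtype_exists (wo_sub woA (@segment_sub _ r A x)).
  by exists a.
have flt x y : A y -> segment r A y x -> ordtype_lt (f x) (f y).
  move=> Ay xy; apply/(ordtype_ltP _ (fP _ Ay)); exists x => //.
  by rewrite (segment_segment woA Ay xy); apply: fP; case: xy.
exists f => // x y Ax Ay; apply/idP/idP => [/ordtype_leP nyx|rxy].
  have [//|ryx] := wo_total woA Ax Ay.
  have [->|nxy] := pselect (x = y); first exact: (wo_refl woA).
  by case: nyx; apply: flt => //; split=> // /esym.
have [->|nxy] := pselect (x = y); first by apply/asboolP; left.
by apply/asboolP; right; apply: flt.
Qed.

Lemma ordtype_below a r A (f : B -> ordtype B) :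
  has_ordtype r A a -> (forall x, A x -> has_ordtype r (segment r A x) (f x)) ->
  (forall x, A x -> ordtype_lt (f x) a) /\
  forall b, ordtype_lt b a -> exists2 x, A x & f x = b.
Proof.
move=> ha fP; split=> [x Ax|b /(ordtype_ltP _ ha)[x Ax hx]].
  by apply/(ordtype_ltP _ ha); exists x => //; apply: fP.
by exists x => //; apply: has_ordtype_inj (fP _ Ax) hx.
Qed.

(* Burali-Forti: otherwise [ordtype B] itself would be isomorphic to a subset
   of [B], hence would have an order type [a], and would be isomorphic to its
   own initial segment below [a]. *)
Lemma hartogs (g : ordtype B -> B) : ~ injective g.
Proof.
move=> ginj.
have [h hK] : exists h : B -> ordtype B, forall a, h (g a) = a.
  have /choice[h hP] : forall x, exists b, forall a, x = g a -> b = a.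
    move=> x; have [[a ->]|nx] := pselect (exists a, x = g a).
      by exists a => b /ginj.
    (* Off the range of [g], the left inverse [h] takes a default ordinal: the type of the empty
       set. *)
    have wo0 : wo_chain (fun _ _ => true) [in @set0 B].
      by apply/wo_chainP; split=> [? ? []|S S0 [y /S0[]]].
    have [r0 _] := has_ordtype_exists wo0.
    by exists r0 => a xa; case: nx; exists a.
  by exists h => a; apply: hP.
pose r x y := ordtype_le (h x) (h y); pose A := range g.
have woA : wo_chain r [in A].
  apply/wo_chainP; split.
    by move=> _ _ [a _ <-] [b _ <-]; rewrite /r !hK => ? ?; congr g;
      apply: ordtype_le_anti.
  move=> S SA [_ /[dup]/SA[a _ <-] Sa].
  have [b Sb bmin] := @ordtype_min (g @^-1` S) (ex_intro _ a Sa).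
  by exists (g b) => // _ /[dup]/SA[c _ <-] Sc; rewrite /r !hK; apply: bmin.
have [a ha] := has_ordtype_exists woA.
have Aga : A (g a) by exists a.
apply: (wo_not_iso_segment woA Aga).
have [s [D hD]] := has_ordtype_rep a.
apply: order_iso_trans (has_ordtype_iso ha hD) _.
have [f fP fmono] := segment_ordtype_iso (has_ordtype_wo hD).
have [f1 f2] := ordtype_below hD fP.
apply/order_isoP; exists (g \o f); split => /=.
- move=> x Dx; split; first by exists (f x).
  + by rewrite /r !hK; apply: ordtype_ltW; apply: f1.
  + by move=> /ginj fx; apply: (@ordtype_lt_irrefl a); rewrite -{1}fx; apply: f1.
- move=> _ [[b _ <-]]; rewrite /r !hK => /asboolP[->//|/f2[x Dx <-] _].
  by exists x.
- move=> x y Dx Dy /ginj fxy; apply: (wo_anti (has_ordtype_wo hD)) => //.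
    by rewrite -fmono // fxy; apply/asboolP; left.
  by rewrite -fmono // fxy; apply/asboolP; left.
- by move=> x y Dx Dy; rewrite /r !hK fmono.
Qed.

End OrdinalTypes.

(** The predecessor of [b] is the type of the segment below the greatest element. Conversely, if
    that segment were cut at a point [m] with some [x] above it, the segment of [x] would have a
    type strictly in between. *)
Lemma ordtype_succP (B : Type) (r : rel B) (A : set B) b : has_ordtype r A b ->
  (exists a, ordtype_succ a b) <-> exists2 m, A m & forall x, A x -> r x m.
Proof.
move=> hb; have woA := has_ordtype_wo hb; split.
  move=> [a [/(ordtype_ltP _ hb)[m Am hm] amin]]; exists m => // x Ax.
  have [//|rmx] := wo_total woA Ax Am.
  apply: contrapT => nxm.
  have mx : segment r A x m.
    by split=> // mx; apply: nxm; rewrite -mx; apply: (wo_refl woA).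
  have [c hc] := has_ordtype_exists (wo_sub woA (@segment_sub _ r A x)).
  have ac : ordtype_lt a c.
    by apply/(ordtype_ltP _ hc); exists m => //; rewrite (segment_segment woA).
  have cb : ordtype_lt c b by apply/(ordtype_ltP _ hb); exists x.
  have [bc|bc] := amin _ ac.
    by subst b; case: (ordtype_lt_irrefl cb).
  by case: (ordtype_lt_irrefl (ordtype_lt_trans cb bc)).
move=> [m Am mmax].
have [a ha] := has_ordtype_exists (wo_sub woA (@segment_sub _ r A m)).
exists a; split; first by apply/(ordtype_ltP _ hb); exists m.
move=> c ac; have [|//|] := ordtype_total b c; [by left|by right|].
move=> /(ordtype_ltP _ hb)[x Ax hx].
suff : ordtype_le c a by move=> /ordtype_leP /(_ ac).
have [xm|nxm] := pselect (x = m).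
  by subst x; apply/asboolP; left; apply: has_ordtype_inj hx ha.
apply: ordtype_ltW; apply/(ordtype_ltP _ ha).
have xm : segment r A m x by split=> //; apply: mmax.
by exists x => //; rewrite (segment_segment woA).
Qed.

Lemma ordtype_zero_succ (B : Type) (a b : ordtype B) :
  ordtype_zero b -> ~ ordtype_succ a b.
Proof. by move=> b0 [ab _]; apply: b0 ab. Qed.

(** * Cardinality and wispiness *)

Section Cardinals.

Lemma card_le_inj (T U : Type) (A : set T) (B : set U) (f : T -> U) :
  (forall x, A x -> B (f x)) ->
  (forall x y, A x -> A y -> f x = f y -> x = y) -> A #<= B.
Proof.
move=> fAB finj.
have : f @` A #= A.
  by apply: inj_card_eq => x y /set_mem Ax /set_mem Ay; apply: finj.
rewrite card_eq_le => /andP[_] /card_le_trans; apply.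
by apply: subset_card_le => _ [x Ax <-]; apply: fAB.
Qed.

Lemma card_le_setT (T U : Type) : [set: T] #<= [set: U] ->
  exists f : T -> U, injective f.
Proof.
move=> /card_leP[f].
have memT (V : Type) (x : V) : x \in [set: V] by apply/mem_set.
exists (fun x => val (f (SigSub (memT _ x)))) => x y /val_inj.
by move=> /(@inj _ _ _ f); rewrite !in_setT => /(_ isT isT) /(congr1 val).
Qed.

(** After well-ordering [K], each point is sent to the ordinal of its segment; distinct points have
    non-isomorphic segments. *)
Lemma card_le_card_succ (K : Type) : [set: K] #<= [set: card_succ K].
Proof.
have [r woK] := @well_ordering_principle {classic K}.
have woT : wo_chain r [in [set: K]].
  move=> A _; exact: woK.
have [f fP _] := segment_ordtype_iso woT.
apply: (card_le_inj (f := f)) => // x y _ _ fxy.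
apply: (wo_segment_inj woT) => //.
apply: (has_ordtype_iso (fP _ I)); rewrite fxy; exact: fP.
Qed.

Lemma card_lt_card_succ (T K : Type) (A : set T) :
  A #<= [set: K] -> card_lt A [set: card_succ K].
Proof.
move=> AK; split; first exact: card_le_trans AK (card_le_card_succ K).
move=> /card_le_trans /(_ AK) /card_le_setT[f]; exact: hartogs.
Qed.

End Cardinals.

(** * Twigs and the wispiness bound *)

Section Wispy.
Context (R : realType) (d : Order.disp_t) (X : porderType d).
Implicit Types (A C : set X).

Lemma twig_neq0 A : twig R A -> A !=set0.
Proof.
move=> [[_ [I [[_ [f [_ _ fsurj] _]] [s [_ [Is _ _]]]]]] _].
by have [x Ax _] := fsurj _ Is; exists x.
Qed.

(** If neither twig contained the other, points [a] of [A] outside [C] and [c] of [C] outside [A]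
    would both lie below [x], hence be comparable, against upward closure. So one contains the
    other, and maximality gives equality. *)
Lemma twig_meet A C x : tree_order X -> twig R A -> twig R C -> A x -> C x ->
  A = C.
Proof.
move=> [_ lin] tA tC Ax Cx.
have chain (D : set X) y z : twig R D -> D y -> D z -> y <= z \/ z <= y.
  move=> [[_ [I [[_ [f _ fmono]] _]]] _] Dy Dz.
  have mono := fmono _ _ (mem_set Dy) (mem_set Dz).
  have mono' := fmono _ _ (mem_set Dz) (mem_set Dy).
  by have /orP[] := le_total (f y) (f z); rewrite ?mono ?mono' => ?; [left|right].
have [[upA _] maxA] := tA; have [[upC _] maxC] := tC.
have [AC|/existsNP[a /not_implyP[Aa nCa]]] := pselect (A `<=` C).
  by rewrite (maxA C) //; case: tC.
have [CA|/existsNP[c /not_implyP[Cc nAc]]] := pselect (C `<=` A).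
  by rewrite (maxC A) //; case: tA.
have ax : a <= x.
  by have [//|xa] := chain A a x tA Aa Ax; case: nCa; apply: upC xa.
have cx : c <= x.
  by have [//|xc] := chain C c x tC Cc Cx; case: nAc; apply: upA xc.
have [ac|ca] := lin x a c ax cx; first by case: nAc; apply: upA ac.
by case: nCa; apply: upC ca.
Qed.

Lemma tree_order_wispy (K : Type) : tree_order X -> [set: X] #<= [set: K] ->
  wispy R X (card_succ K).
Proof.
move=> treeX XK; split; apply: card_lt_card_succ; apply: card_le_trans XK.
  by apply: subset_card_le.
have /choice[f fP] : forall A, exists x, twig R A -> A x.
  move=> A; have [/twig_neq0[x Ax]|] := pselect (twig R A); first by exists x.
  (* Sets that are not twigs get the minimum as a dummy point. *)
  by have [[m _] _] := treeX; exists m.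
apply: (card_le_inj (f := f)) => // A C tA tC fAC.
by apply: (twig_meet treeX tA tC (fP _ tA)); rewrite fAC; apply: fP.
Qed.

End Wispy.

(** * Levels, paddings and roads *)

Section Levels.
Context (d : Order.disp_t) (T : porderType d).
Implicit Types x y z : T.

(** An ordinal-free substitute for successor levels, justified by [on_successor_levelP] and
    [on_zero_or_limit_levelP]. *)
Definition has_pred x := exists2 m, m < x & forall y, y < x -> y <= m.

Definition well_stratified := forall x, wo_chain <=%O [in [set y | y <= x]].

Hypothesis wsT : well_stratified.

Lemma ws_lin x y z : y <= x -> z <= x -> y <= z \/ z <= y.
Proof. by move=> yx zx; apply: (wo_total (@wsT x)). Qed.

Lemma ws_level x : exists a, level a x.
Proof.
apply: has_ordtype_exists; apply: (wo_sub (@wsT x)).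
by move=> y /ltW.
Qed.

Lemma on_successor_levelP x : on_successor_level x <-> has_pred x.
Proof.
split=> [[a [b [sab lb]]]|].
  exact: (ordtype_succP lb).1 (ex_intro _ a sab).
have [b lb] := ws_level x.
by move=> /(ordtype_succP lb).2[a sab]; exists a, b.
Qed.

Lemma on_zero_or_limit_levelP x : on_zero_or_limit_level x <-> ~ has_pred x.
Proof.
split=> [[a la ha] /(ordtype_succP la).2[b sba]|npx].
  by case: ha => [/ordtype_zero_succ/(_ sba)|[_ /(_ b)]].
have [b lb] := ws_level x; exists b => //.
have [?|nb] := pselect (ordtype_zero b); [by left|right; split=> // a sab].
by apply: npx; apply/(ordtype_succP lb); exists a.
Qed.

End Levels.

(** * The padded tree *)

Section PadTheory.
Context (d : Order.disp_t) (T : porderType d) (wsT : well_stratified T).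
Implicit Types (x y : T) (u v w : pad T).

Definition base u : T := match u with Node x => x | Minus x => val x end.

Lemma pad_leE u v : (u <= v) = pad_le u v. Proof. by []. Qed.

Lemma pad_ltE u v : (u < v) = match u, v with
  | Node x, Node y => x < y
  | Node y, Minus x => y < val x
  | Minus x, Node y => val x <= y
  | Minus x, Minus y => val x < val y
  end.
Proof.
rewrite lt_neqAle pad_leE; case: u v => [x|x] [y|y] /=; rewrite ?lt_neqAle.
- by congr (~~ _ && _); apply/eqP/eqP => [[]|->].
- by case: eqP.
- by case: eqP.
- by congr (~~ _ && _); apply/eqP/eqP => [[->]|/val_inj->].
Qed.

Lemma base_le u v : u <= v -> base u <= base v.
Proof. by case: u v => [x|x] [y|y] //= /ltW. Qed.

Lemma base_lt u v : base u < base v -> u < v.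
Proof. by rewrite pad_ltE; case: u v => [x|x] [y|y] //= /ltW. Qed.

Lemma pad_well_stratified : well_stratified (pad T).
Proof.
move=> u; apply/wo_chainP; split=> [v w _ _ vw wv|S Su [v Sv]].
  by apply/le_anti; rewrite vw wv.
have [||x [w Sw wx] xmin] := wo_min (@wsT (base u)) (S := base @` S).
- by move=> _ [w /Su wu <-]; apply: base_le.
- by exists (base v), v.
(* Over the least base [x], at most [Minus x] and [Node x] compete, and [Minus x] wins when it is in
   [S]. *)
have [[y Sy yx]|nS] := pselect (exists2 y, S (Minus y) & val y = x).
  exists (Minus y) => // z Sz; rewrite pad_leE /=.
  have := xmin (base z) (ex_intro2 _ _ z Sz erefl); rewrite -yx.
  by case: z {Sz}.
exists w => // z Sz; have xz := xmin (base z) (ex_intro2 _ _ z Sz erefl).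
case: w Sw wx => [y|y] Sw /= yx; last by case: nS; exists y.
move: xz Sz; case: z => [z|z] //=; rewrite pad_leE /= yx // => xz Sz.
by rewrite lt_neqAle xz andbT; apply/eqP => xz'; apply: nS; exists z.
Qed.

(** A predecessor of [x] in [T] remains one after padding, since no [Minus] node is then inserted
    below [x]. Otherwise [x] lies on level zero or a limit level, and its [Minus] node is the
    predecessor. *)
Lemma Node_has_pred x : has_pred (Node x).
Proof.
have [[m mx mmax]|npx] := pselect (has_pred x).
  exists (Node m); first by rewrite pad_ltE.
  case=> [y|y]; rewrite pad_ltE pad_leE /=; first exact: mmax.
  move=> yx; apply: (mmax); rewrite lt_neqAle yx andbT; apply/eqP => yx'.
  have : ~ has_pred (val y).
    by apply/(on_zero_or_limit_levelP wsT)/asboolP; case: (y).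
  have -> : val y = x by [].
  by apply; exists m.
have hx : `[< on_zero_or_limit_level x >].
  by apply/asboolP/(on_zero_or_limit_levelP wsT).
exists (Minus (exist _ x hx)); first by rewrite pad_ltE.
by case=> [y|y]; rewrite pad_ltE pad_leE.
Qed.

(** A predecessor [Node y] would make [y] a predecessor of [x] in [T], and [Minus y] is never the
    last one because [Node y] still fits above it. *)
Lemma Minus_not_has_pred (x : {x : T | `[< on_zero_or_limit_level x >]}) :
  ~ has_pred (Minus x).
Proof.
have : ~ has_pred (val x).
  by apply/(on_zero_or_limit_levelP wsT)/asboolP; case: x.
move=> npx [[y|y]]; rewrite pad_ltE => yx mmax.
  apply: npx; exists y => // z zx.
  by have := mmax (Node z); rewrite pad_ltE; apply.
have := mmax (Node (val y)); rewrite pad_ltE pad_leE /= => /(_ yx).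
by rewrite ltxx.
Qed.

(** For incomparable [u] and [v], the infimum [x] of the bases lies strictly below both, so [Node x]
    is a lower bound; it is the top node over [x], hence the greatest one. *)
Lemma pad_infimums : (forall x y, infimums [set x; y] !=set0) ->
  forall u v, infimums [set u; v] !=set0.
Proof.
move=> infT u v.
have infl (w w' : pad T) : w <= w' -> infimums [set w; w'] w.
  move=> ww'; split; first by move=> _ [->|->].
  by move=> z; apply; left.
have [uv|nuv] := boolP (u <= v); first by exists u; apply: infl.
have [vu|nvu] := boolP (v <= u); first by exists v; rewrite setUC; apply: infl.
have [x [xlb xinf]] := infT (base u) (base v).
have xu : x < base u.
  rewrite lt_neqAle xlb ?andbT; last by left.
  apply/eqP => xu; have : base u <= base v by rewrite -xu; apply: xlb; right.
  rewrite le_eqVlt => /orP[/eqP uv|/base_lt/ltW uv]; last by rewrite uv in nuv.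
  case: u v uv nuv nvu {xlb xinf xu} => [a|a] [b|b] /=; rewrite !pad_leE /= => ->;
    by rewrite lexx.
have xv : x < base v.
  rewrite lt_neqAle xlb ?andbT; last by right.
  apply/eqP => xv; have : base v <= base u by rewrite -xv; apply: xlb; left.
  rewrite le_eqVlt => /orP[/eqP uv|/base_lt/ltW uv]; last by rewrite uv in nvu.
  case: u v uv nuv nvu {xlb xinf xu xv} => [a|a] [b|b] /=; rewrite !pad_leE /= => ->;
    by rewrite lexx.
exists (Node x); split; first by move=> _ [->|->]; apply/ltW/base_lt.
move=> w wlb.
have : base w <= x.
  by apply: xinf => _ [->|->]; apply: base_le; apply: wlb; [left|right].
by case: w {wlb}.
Qed.

End PadTheory.

(** * The road over a tree *)

Section RoadTheory.
Context (R : realType) (d : Order.disp_t) (T : porderType d).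
Implicit Types (p q : T) (t s : R) (u v w : road R T).

Lemma road_leE u v : (u <= v) =
  ((road_val u).1 <= (road_val v).1) &&
  (((road_val v).1 <= (road_val u).1) ==> ((road_val u).2 <= (road_val v).2)%R).
Proof. by []. Qed.

Lemma road_le1 u v : u <= v -> (road_val u).1 <= (road_val v).1.
Proof. by rewrite road_leE => /andP[]. Qed.

Lemma road_lt1 u v : (road_val u).1 < (road_val v).1 -> u < v.
Proof.
move=> uv; rewrite lt_neqAle road_leE (ltW uv) /= (lt_geF uv) andbT.
by apply/eqP => e; rewrite e ltxx in uv.
Qed.

Lemma road_le2 u v : (road_val u).1 = (road_val v).1 ->
  (u <= v) = ((road_val u).2 <= (road_val v).2)%R.
Proof. by rewrite road_leE => ->; rewrite lexx. Qed.

Lemma road_val2 u : (0 < (road_val u).2 <= 1)%R.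
Proof. by case: u => u /= /andP[]. Qed.

Lemma road_point1 p : exists u, road_val u = (p, 1%R).
Proof.
have h : in_road ((p, 1%R) : T *lexi[d] R).
  by rewrite /in_road /= ltr01 lexx eqxx.
by exists (RoadPoint h).
Qed.

Lemma road_point p t : (0 < t <= 1)%R -> on_successor_level p ->
  exists u, road_val u = (p, t).
Proof.
move=> t01 /asboolP sp.
have h : in_road ((p, t) : T *lexi[d] R) by rewrite /in_road /= t01 sp orbT.
by exists (RoadPoint h).
Qed.

Lemma road_lin : (forall p q r : T, p <= r -> q <= r -> p <= q \/ q <= p) ->
  forall u v w, u <= w -> v <= w -> u <= v \/ v <= u.
Proof.
move=> linT u v w /road_le1 uw /road_le1 vw.
have [uv|nuv] := eqVneq (road_val u).1 (road_val v).1.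
  by rewrite !road_le2 //; apply/orP; apply: le_total.
have [uv|vu] := linT _ _ _ uw vw; [left|right]; apply/ltW/road_lt1.
  by rewrite lt_neqAle nuv.
by rewrite lt_neqAle eq_sym nuv.
Qed.

(** For incomparable points, the infimum [p] of the nodes lies strictly below both nodes, so the
    last point over [p], at height 1, is the infimum. *)
Lemma road_infimums : (forall p q : T, infimums [set p; q] !=set0) ->
  forall u v, infimums [set u; v] !=set0.
Proof.
move=> infT u v.
have infl w w' : w <= w' -> infimums [set w; w'] w.
  move=> ww'; split; first by move=> _ [->|->].
  by move=> z; apply; left.
have [uv|nuv] := boolP (u <= v); first by exists u; apply: infl.
have [vu|nvu] := boolP (v <= u); first by exists v; rewrite setUC; apply: infl.
have [p [plb pinf]] := infT (road_val u).1 (road_val v).1.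
have key w w' : ~~ (w <= w') -> ~~ (w' <= w) -> p <= (road_val w).1 ->
    p <= (road_val w').1 -> p < (road_val w).1.
  move=> nww nww' pw pw'; rewrite lt_neqAle pw andbT; apply/eqP => e.
  move: pw'; rewrite e le_eqVlt => /orP[/eqP e'|/road_lt1/ltW]; last exact/negP.
  move: nww nww'; rewrite !road_le2 // => /negPf nww /negPf nww'.
  by have := le_total (road_val w).2 (road_val w').2; rewrite nww nww'.
have pu := plb _ (or_introl erefl); have pv := plb _ (or_intror erefl).
have [z zE] := road_point1 p; exists z; split.
  by move=> _ [->|->]; apply/ltW/road_lt1; rewrite zE /=; apply: key; eauto.
move=> w wlb; rewrite road_leE zE /=.
have wp : (road_val w).1 <= p.
  by apply: pinf => _ [->|->]; apply: road_le1; apply: wlb; [left|right].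
by have /andP[_ ->] := road_val2 w; rewrite wp implybT.
Qed.

End RoadTheory.

(** * Injective functions into omega *)

Section InOmega.
Implicit Types (f g h : In_omega) (a b c : ordtype nat) (n m : nat)
  (G : set (ordtype nat * nat)).

Lemma graphP f : injective_function (graph f).
Proof. by case: f => G /= /asboolP. Qed.

Lemma graph_fun f b m n : graph f (b, m) -> graph f (b, n) -> m = n.
Proof. by have [_ h _] := graphP f; apply: h. Qed.

Lemma graph_inj f b c n : graph f (b, n) -> graph f (c, n) -> b = c.
Proof. by have [_ _ h] := graphP f; apply: h. Qed.

Lemma In_omega_leP f g : f <= g <-> graph f `<=` graph g.
Proof. by rewrite -subsetEset. Qed.

Lemma graph_len_exists f :
  exists a, forall b, (exists n, graph f (b, n)) <-> ordtype_lt b a.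
Proof. by have [] := graphP f. Qed.

Definition len f : ordtype nat := projT1 (cid (graph_len_exists f)).

Lemma lenP f b : (exists n, graph f (b, n)) <-> ordtype_lt b (len f).
Proof. by rewrite /len; case: cid. Qed.

Lemma graph_len f b n : graph f (b, n) -> ordtype_lt b (len f).
Proof. by move=> fbn; apply/lenP; exists n. Qed.

(* A downward closed set of ordinals that injects into [nat] is a proper initial
   segment, because [ordtype nat] does not inject into [nat]. *)
Lemma In_omega_mk G :
  (forall b c n, G (b, n) -> ordtype_lt c b -> exists m, G (c, m)) ->
  (forall b m n, G (b, m) -> G (b, n) -> m = n) ->
  (forall b c n, G (b, n) -> G (c, n) -> b = c) ->
  exists f, graph f = G.
Proof.
move=> down func inj.
suff ifG : injective_function G.
  by unshelve eexists; [apply: (@InOmega G); apply/asboolP|].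
split=> //.
have [/choice[e eP]|/existsNP[a0 na0]] := pselect (forall b, exists n, G (b, n)).
  exfalso; apply: (@hartogs _ e) => b c ebc.
  by apply: (inj _ _ (e b)); [exact: eP|rewrite ebc; exact: eP].
have [a na amin] := @ordtype_min _ [set b | ~ exists n, G (b, n)] (ex_intro _ a0 na0).
exists a => b; split=> [[n Gbn]|ba].
  have [ab|//|ab] := ordtype_total b a; first by case: na; exists n; rewrite -ab.
  by case: na; apply: down ab; exact: Gbn.
by apply: contrapT => /amin /ordtype_leP.
Qed.

Lemma len_unique f a :
  (forall b, (exists n, graph f (b, n)) <-> ordtype_lt b a) -> len f = a.
Proof.
move=> h; have [//|ab|ab] := ordtype_total (len f) a.
  by have /lenP /ordtype_lt_irrefl := (h _).2 ab.
by have /h /ordtype_lt_irrefl := (lenP _ _).2 ab.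
Qed.

Lemma graph_le f g b n : f <= g -> graph f (b, n) -> graph g (b, n).
Proof. by move=> /In_omega_leP; apply. Qed.

(** Below a common [h] both functions are restrictions of [h], so length alone decides the order. *)
Lemma len_le_below f g h : f <= h -> g <= h -> ordtype_le (len f) (len g) -> f <= g.
Proof.
move=> fh gh lfg; apply/In_omega_leP => -[b n] fbn.
have /lenP[m gbm] := ordtype_lt_le_trans (graph_len fbn) lfg.
by rewrite (graph_fun (graph_le fh fbn) (graph_le gh gbm)).
Qed.

Lemma len_lt f g : f < g -> ordtype_lt (len f) (len g).
Proof.
rewrite lt_neqAle => /andP[nfg fg]; apply: contrapT => /ordtype_leP lgf.
by move/eqP: nfg; apply; apply/le_anti; rewrite fg (len_le_below _ fg lgf).
Qed.

Lemma In_omega_well_stratified : well_stratified In_omega.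
Proof.
move=> f; apply/wo_chainP; split=> [g h _ _ gh hg|S Sf [g Sg]].
  by apply/le_anti; rewrite gh.
have [|a [h Sh <-] hmin] := @ordtype_min _ (len @` S).
  by exists (len g), g.
exists h => // k Sk; apply: len_le_below (Sf _ Sh) (Sf _ Sk) _.
by apply: hmin; exists k.
Qed.

Lemma In_omega_infimums f g : infimums [set f; g] !=set0.
Proof.
(* The last clause cuts the intersection at the first disagreement of [f] and [g], which makes the
   domain downward closed. *)
pose G : set (ordtype nat * nat) := [set p | [/\ graph f p, graph g p &
  forall c, ordtype_lt c p.1 -> exists n, graph f (c, n) /\ graph g (c, n)]].
have [|||h hG] := @In_omega_mk G.
- move=> b c n [_ _ hb] cb; have [m [fm gm]] := hb _ cb.
  by exists m; split=> //= e ec; apply: hb; apply: ordtype_lt_trans cb.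
- by move=> b m n [+ _ _] [+ _ _]; apply: graph_fun.
- by move=> b c n [+ _ _] [+ _ _]; apply: graph_inj.
exists h; split.
  by move=> _ [->|->]; apply/In_omega_leP; rewrite hG => p [].
move=> k klb.
have kf : k <= f by apply: klb; left.
have kg : k <= g by apply: klb; right.
apply/In_omega_leP => -[b n] kbn; rewrite hG; split=> /=.
- exact: graph_le kbn.
- exact: graph_le kbn.
- move=> c cb; have /lenP[m kcm] := ordtype_lt_trans cb (graph_len kbn).
  by exists m; split; [apply: graph_le kcm|apply: graph_le kcm].
Qed.

Lemma In_omega_bottom : exists f, forall g, f <= g.
Proof.
have [//|//|//|f fG] := @In_omega_mk set0.
by exists f => g; apply/In_omega_leP; rewrite fG => p [].
Qed.

Lemma In_omega_restr f a : exists g,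
  graph g = [set p | graph f p /\ ordtype_lt p.1 a].
Proof.
apply: In_omega_mk.
- move=> b c n [/= fbn ba] cb.
  have /lenP[m fcm] := ordtype_lt_trans cb (graph_len fbn).
  by exists m; split=> //=; apply: ordtype_lt_trans ba.
- by move=> b m n [+ _] [+ _]; apply: graph_fun.
- by move=> b c n [+ _] [+ _]; apply: graph_inj.
Qed.

Definition restr f a : In_omega := projT1 (cid (In_omega_restr f a)).

Lemma graph_restr f a :
  graph (restr f a) = [set p | graph f p /\ ordtype_lt p.1 a].
Proof. by rewrite /restr; case: cid. Qed.

Lemma restr_le f a : restr f a <= f.
Proof. by apply/In_omega_leP; rewrite graph_restr => p []. Qed.

Lemma len_restr f a : ordtype_lt a (len f) -> len (restr f a) = a.
Proof.
move=> af; apply: len_unique => b; rewrite graph_restr; split=> [[n []]//|ba].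
by have /lenP[n fbn] := ordtype_lt_trans ba af; exists n.
Qed.

Lemma restr_lt f a : ordtype_lt a (len f) -> restr f a < f.
Proof.
move=> af; rewrite lt_neqAle restr_le andbT; apply/eqP => e.
by move: (len_restr af); rewrite e => e'; rewrite e' in af; apply: ordtype_lt_irrefl af.
Qed.

Lemma In_omega_snoc f n : (forall b, ~ graph f (b, n)) ->
  exists g, graph g = graph f `|` [set (len f, n)].
Proof.
move=> nfn; apply: In_omega_mk.
- move=> b c m [/= fbm|[-> _]] cb.
    by have /lenP[k fck] := ordtype_lt_trans cb (graph_len fbm); exists k; left.
  by have /lenP[k fck] := cb; exists k; left.
- move=> b k m [/= fbk|[eb ek]] [/= fbm|[eb' em]].
  + exact: graph_fun fbm.
  + by have := graph_len fbk; rewrite eb' => /ordtype_lt_irrefl.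
  + by have := graph_len fbm; rewrite eb => /ordtype_lt_irrefl.
  + by rewrite ek em.
- move=> b c m [/= fbm|[-> em]] [/= fcm|[-> em']] //.
  + exact: graph_inj fcm.
  + by case: (nfn b); rewrite -em'.
  + by case: (nfn c); rewrite -em.
Qed.

(** The next node after [f] towards [g] adjoins the single value [n] of [g] at [len f]. Nothing fits
    strictly between, as only one ordinal is added to the domain. *)
Lemma In_omega_next f g : f < g -> exists h n,
  [/\ forall b, ~ graph f (b, n), graph h = graph f `|` [set (len f, n)],
      f < h, h <= g & forall k, k < h -> k <= f].
Proof.
move=> fg; have /lenP[n gn] := len_lt fg.
have nf b : ~ graph f (b, n).
  move=> fbn; have := graph_inj gn (graph_le (ltW fg) fbn) => e.
  by move: fbn; rewrite -e => /graph_len /ordtype_lt_irrefl.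
have [h hG] := In_omega_snoc nf; exists h, n.
have fh : f <= h by apply/In_omega_leP; rewrite hG; left.
have hn : graph h (len f, n) by rewrite hG; right.
split=> //.
- rewrite lt_neqAle fh andbT; apply/eqP => e.
  by move: hn; rewrite -e => /nf.
- apply/In_omega_leP; rewrite hG => -[b m] [/(graph_le (ltW fg))//|[-> ->]] //.
- move=> k kh; apply: (len_le_below (ltW kh) fh).
  apply/ordtype_leP => /lenP[m km]; have := len_lt kh.
  apply/ordtype_leP; apply/ordtype_leP => /lenP[p hp].
  move: hp; rewrite hG => -[/graph_len fk|[e _]].
    by apply: (@ordtype_lt_irrefl _ (len f)); apply: ordtype_lt_trans (graph_len km) fk.
  by move: (graph_len km); rewrite e; apply: ordtype_lt_irrefl.
Qed.

End InOmega.

(** * Heights *)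

Section BinaryMeasure.
Context (R : realType).
Implicit Types (S : set nat) (n N : nat) (x : R).
Local Open Scope ring_scope.

Definition weight n : R := (2^-1) ^+ n.+1.

Definition partial_mass S N : R :=
  \sum_(i < N) if `[< S i >] then weight i else 0.

(** The sum of the series of weights over [S]: the partial sums increase, so a supremum replaces the
    limit. *)
Definition mass S : R := sup (range (partial_mass S)).

Lemma weight_gt0 n : 0 < weight n.
Proof. by rewrite exprn_gt0 // invr_gt0 ltr0n. Qed.

Lemma partial_massS S N :
  partial_mass S N.+1 = partial_mass S N + if `[< S N >] then weight N else 0.
Proof. exact: big_ord_recr. Qed.

Lemma partial_mass_le S N : partial_mass S N <= partial_mass S N.+1.
Proof.
by rewrite partial_massS lerDl; case: ifP => // _; apply/ltW/weight_gt0.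
Qed.

Lemma partial_mass_nondecreasing S N M :
  (N <= M)%N -> partial_mass S N <= partial_mass S M.
Proof.
move=> /subnK <-; elim: (M - N)%N => [|k ih]; first by rewrite add0n.
by rewrite addSn; apply: le_trans ih (partial_mass_le _ _).
Qed.

Lemma partial_mass_sub S S' N : (forall n, (n < N)%N -> S n -> S' n) ->
  partial_mass S N <= partial_mass S' N.
Proof.
move=> SS'; apply: ler_sum => i _.
case: asboolP => [/(SS' _ (ltn_ord i))/asboolP ->//|_].
by case: ifP => // _; apply/ltW/weight_gt0.
Qed.

Lemma partial_mass_le1 S N : partial_mass S N <= 1.
Proof.
(* The bound is sharpened to the sum of the first [N] weights so that induction goes through. *)
suff : partial_mass S N <= 1 - (2^-1) ^+ N.
  by move=> /le_trans; apply; rewrite gerBl exprn_ge0 // invr_ge0 ler0n.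
elim: N => [|N ih]; first by rewrite /partial_mass big_ord0 expr0 subrr.
rewrite partial_massS.
have h : (if `[< S N >] then weight N else 0) <= weight N.
  by case: ifP => // _; apply/ltW/weight_gt0.
have e : (2^-1 : R) ^+ N = weight N + weight N.
  rewrite /weight exprS -mulrDl -mulr2n -[_^-1 *+ 2]mulr_natl.
  by rewrite mulfV ?mul1r // pnatr_eq0.
apply: le_trans (lerD ih h) _; rewrite e -/(weight N) opprD.
by rewrite addrA subrK.
Qed.

Lemma partial_mass_mass S N : partial_mass S N <= mass S.
Proof.
apply: ub_le_sup; last by exists N.
by exists 1 => _ [M _ <-]; apply: partial_mass_le1.
Qed.

Lemma mass_le S x : (forall N, partial_mass S N <= x) -> mass S <= x.
Proof.
move=> h; apply: ge_sup; first by exists (partial_mass S 0), 0%N.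
by move=> _ [M _ <-].
Qed.

Lemma mass_gt S x : x < mass S -> exists N, x < partial_mass S N.
Proof.
move=> xS; apply: contrapT => /forallNP h.
suff : mass S <= x by rewrite leNgt xS.
by apply: mass_le => N; rewrite leNgt; apply/negP/h.
Qed.

Lemma mass_sub S S' : S `<=` S' -> mass S <= mass S'.
Proof.
move=> SS'; apply: mass_le => N; apply: le_trans (partial_mass_mass S' N).
by apply: partial_mass_sub => n _; apply: SS'.
Qed.

Lemma mass_ge0 S : 0 <= mass S.
Proof.
by have := partial_mass_mass S 0; rewrite /partial_mass big_ord0.
Qed.

Lemma mass_add S n : ~ S n -> mass (S `|` [set n]) = mass S + weight n.
Proof.
move=> nSn; have e N : partial_mass (S `|` [set n]) N =
    partial_mass S N + if (n < N)%N then weight n else 0.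
  elim: N => [|N ih]; first by rewrite /partial_mass !big_ord0 addr0.
  rewrite !partial_massS ih; have [nN|Nn|eN] := ltngtP n N.
  - rewrite (leq_trans nN) // addrAC; congr (_ + _ + _).
    congr (if _ then _ else _); apply: asbool_equiv_eq; split; last by left.
    by move=> [//|/= e]; rewrite e ltnn in nN.
  - rewrite ltnNge (leq_trans Nn) // !addr0; congr (_ + _).
    congr (if _ then _ else _); apply: asbool_equiv_eq; split; last by left.
    by move=> [//|/= e]; rewrite e ltnn in Nn.
  - subst N; rewrite ltnSn; case: asboolP => [_|]; last by case; right.
    by case: asboolP => // _; rewrite !addr0.
apply/le_anti/andP; split.
  apply: mass_le => N; rewrite e lerD ?partial_mass_mass //.
  by case: ifP => // _; apply/ltW/weight_gt0.
rewrite -lerBrDr; apply: mass_le => N; rewrite lerBrDr.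
(* Past index [n] the partial sum already contains the extra weight. *)
apply: le_trans (partial_mass_mass _ (maxn N n.+1)); rewrite e leq_maxr.
by rewrite lerD2r partial_mass_nondecreasing // leq_maxl.
Qed.

End BinaryMeasure.

(** * Heights of nodes and their continuity *)

Section Position.
Context (R : realType).
Implicit Types (f g h F : In_omega) (r : R).

Definition values f : set nat := [set n | exists b, graph f (b, n)].

Definition position f : R := mass R (values f).

Lemma values_le f g : f <= g -> values f `<=` values g.
Proof. by move=> fg n [b fbn]; exists b; apply: graph_le fbn. Qed.

Lemma position_le f g : f <= g -> (position f <= position g)%R.
Proof. by move=> /values_le; apply: mass_sub. Qed.

Lemma position_ge0 f : (0 <= position f)%R.
Proof. exact: mass_ge0. Qed.

Lemma position_next f g : f < g -> exists h n,
  [/\ f < h, h <= g, forall k, k < h -> k <= f &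
      position h = (position f + weight R n)%R].
Proof.
move=> /In_omega_next[h [n [nf hG fh hg hmin]]]; exists h, n; split=> //.
rewrite /position -mass_add; last by move=> [b /nf].
congr (mass R _); apply/seteqP; split=> m.
  by move=> [b]; rewrite hG => -[fbm|[_ ->]]; [left; exists b|right].
by move=> [[b fbm]|->]; rewrite /values/= hG; [exists b; left|exists (len f); right].
Qed.

Lemma position_lt f g : f < g -> (position f < position g)%R.
Proof.
move=> /position_next[h [n [_ /position_le hg _ e]]]; apply: lt_le_trans hg.
by rewrite e ltrDl weight_gt0.
Qed.

(** If [n] is taken at [b], the restriction of [g] to [b] is not a predecessor of [g], so some [k]
    below [g] is longer than [b] and takes [n] there too. *)
Lemma values_limit g n : ~ has_pred g -> values g n ->
  exists2 k, k < g & values k n.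
Proof.
move=> npg [b gbn].
have /existsNP[k /not_implyP[kg nk]] : ~ forall k, k < g -> k <= restr g b.
  by move=> h; apply: npg; exists (restr g b) => //; apply/restr_lt/graph_len/gbn.
exists k => //.
have /lenP[m km] : ordtype_lt b (len k).
  apply: contrapT => /ordtype_leP lk; apply: nk.
  apply: (len_le_below (ltW kg) (restr_le _ _)).
  by rewrite len_restr //; apply: graph_len gbn.
by exists b; rewrite -(graph_fun (graph_le (ltW kg) km) gbn).
Qed.

(** Some partial sum exceeds [r]. It involves finitely many values of [g], all of which occur in one
    [h] below [g], because the nodes below [g] form a chain. *)
Lemma position_limit g r : ~ has_pred g -> (0 <= r < position g)%R ->
  exists2 h, h < g & (r < position h)%R.
Proof.
move=> npg /andP[r0 /mass_gt[N rN]].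
have lin := ws_lin In_omega_well_stratified.
have [h0|[h hg hN]] : (forall n, (n < N)%N -> ~ values g n) \/
    exists2 h, h < g & forall n, (n < N)%N -> values g n -> values h n.
- elim: N {rN} => [|N ih]; first by left.
  have [/(values_limit npg)[k kg kN]|ngN] := pselect (values g N); last first.
    case: ih => [ih|[h hg ih]]; [left=> n|right; exists h => // n];
      by rewrite ltnS leq_eqVlt => /orP[/eqP->|/ih].
  right; case: ih => [ih|[h hg ih]].
    by exists k => // n; rewrite ltnS leq_eqVlt => /orP[/eqP->|/ih].
  have [hk|kh] := lin g h k (ltW hg) (ltW kg).
    exists k => // n; rewrite ltnS leq_eqVlt => /orP[/eqP->//|nN] gn.
    by apply: values_le hk _ _; apply: ih.
  exists h => // n; rewrite ltnS leq_eqVlt => /orP[/eqP-> _|nN gn].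
    exact: values_le kN.
  exact: ih.
(* With no value of [g] below [N] the partial sum is 0, which [0 <= r] excludes; this covers the
   empty function, which has no node below it. *)
- move: rN; suff -> : partial_mass R (values g) N = 0%R by rewrite ltNge r0.
  by apply: big1 => i _; case: asboolP => // /h0; case.
- exists h => //; apply: lt_le_trans rN _.
  exact: le_trans (partial_mass_sub R hN) (partial_mass_mass R _ _).
Qed.

End Position.

(** * Branches of the road *)

Section RoadInOmega.
Context (R : realType).
Local Notation X := (road R (pad In_omega)).
Implicit Types (u v : X) (f g h F : In_omega) (r : R).

Lemma pad_In_omega_well_stratified : well_stratified (pad In_omega).
Proof. exact: pad_well_stratified In_omega_well_stratified. Qed.

Lemma Node_successor g : on_successor_level (Node g).
Proof.
apply/(on_successor_levelP pad_In_omega_well_stratified).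
exact: (Node_has_pred In_omega_well_stratified).
Qed.

Lemma road_Node g r : (0 < r <= 1)%R -> exists u, road_val u = (Node g, r).
Proof. by move=> r01; apply: road_point => //; apply: Node_successor. Qed.

(** A [Minus] node is not on a successor level, so the road has only one point over it. *)
Lemma road_Minus2 u (g : {x : In_omega | `[< on_zero_or_limit_level x >]}) :
  (road_val u).1 = Minus g -> (road_val u).2 = 1%R.
Proof.
case: u => -[p r] /= /andP[_ /orP[/eqP //|/asboolP/= + e]].
rewrite e => /(on_successor_levelP pad_In_omega_well_stratified).
by move=> /(Minus_not_has_pred In_omega_well_stratified).
Qed.

Definition trunk u : In_omega := base (road_val u).1.

Lemma road_ltE u v : u < v -> (road_val u).1 < (road_val v).1 \/
  exists g, [/\ (road_val u).1 = Node g, (road_val v).1 = Node g &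
    ((road_val u).2 < (road_val v).2)%R].
Proof.
move=> uv; have := road_le1 (ltW uv); rewrite le_eqVlt => /orP[/eqP e|]; last by left.
have r2 : ((road_val u).2 < (road_val v).2)%R.
  by rewrite ltNge -road_le2 // (lt_geF uv).
right; case eu : (road_val u).1 => [g|g]; first by exists g; rewrite -e eu.
have ev : (road_val v).1 = Minus g by rewrite -e.
by rewrite (road_Minus2 eu) (road_Minus2 ev) ltxx in r2.
Qed.

Lemma trunk_le u v : u <= v -> trunk u <= trunk v.
Proof. by move/road_le1/base_le. Qed.

Lemma road_top F : exists u, forall v, (v <= u) = (trunk v <= F).
Proof.
have [u uE] := road_point1 R (Node F); exists u => v.
apply/idP/idP => [/trunk_le|vF]; first by rewrite /trunk uE.
rewrite road_leE uE /=; have /andP[_ ->] := road_val2 v.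
by rewrite implybT andbT; move: vF; rewrite /trunk; case: (road_val v).1.
Qed.

Lemma road_In_omega_lin u v w : u <= w -> v <= w -> u <= v \/ v <= u.
Proof. by apply: road_lin => p q r; exact: (ws_lin pad_In_omega_well_stratified). Qed.

Lemma road_tree_order : tree_order X.
Proof.
split; last by move=> w u v; exact: road_In_omega_lin.
have [f0 f0min] := In_omega_bottom.
have hf0 : `[< on_zero_or_limit_level f0 >].
  apply/asboolP/(on_zero_or_limit_levelP In_omega_well_stratified).
  by move=> [m]; rewrite (le_gtF (f0min m)).
(* The root of the road is the single point over the [Minus] node of the empty function. *)
have [u uE] := road_point1 R (Minus (exist _ f0 hf0)); exists u => v.
have [e|ne] := eqVneq (road_val u).1 (road_val v).1.
  rewrite road_le2 // uE (@road_Minus2 v (exist _ f0 hf0)) //.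
  by rewrite -e uE.
apply/ltW/road_lt1; rewrite lt_neqAle ne uE pad_leE.
by case: (road_val v).1 => [x|x] /=; exact: f0min.
Qed.

(** The union of the trunks along the chain is again a node [F]. The points with trunk at most [F]
    form a chain containing [B], and maximality applies. *)
Lemma road_branch (B : set X) : branch B ->
  exists F, B = [set u | trunk u <= F].
Proof.
move=> [Bchain Bmax].
have lin u v : B u -> B v -> trunk u <= trunk v \/ trunk v <= trunk u.
  by move=> Bu Bv; have [/trunk_le|/trunk_le] := Bchain u v Bu Bv; [left|right].
have [|||F FG] := @In_omega_mk (\bigcup_(u in B) graph (trunk u)).
- move=> b c n [u Bu /graph_len bu] cb.
  by have /lenP[m cm] := ordtype_lt_trans cb bu; exists m, u.
- move=> b m n [u Bu ubm] [v Bv vbn].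
  have [uv|vu] := lin u v Bu Bv.
    exact: graph_fun (graph_le uv ubm) vbn.
  exact: graph_fun ubm (graph_le vu vbn).
- move=> b c n [u Bu ubm] [v Bv vbn].
  have [uv|vu] := lin u v Bu Bv.
    exact: graph_inj (graph_le uv ubm) vbn.
  exact: graph_inj ubm (graph_le vu vbn).
exists F; apply/esym/Bmax.
  have [w wtop] := road_top F => u v /= uF vF.
  by apply: (@road_In_omega_lin _ _ w); rewrite wtop.
by move=> u Bu /=; apply/In_omega_leP; rewrite FG => p up; exists u.
Qed.

(** The gap from [g] to the next node towards [F]. The final step, at [F], gets length 1; nodes off
    the branch get a dummy 1 so that a length function can be chosen on all nodes. *)
Lemma step_length F g : exists w : R,
  [/\ (0 < w)%R, g = F -> w = 1%R & g < F -> exists h,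
    [/\ g < h, h <= F, forall k, k < h -> k <= g &
        position R h = (position R g + w)%R]].
Proof.
have [->|gF] := eqVneq g F; first by exists 1%R; rewrite ltxx ltr01.
have [/(position_next R)[h [n [gh hF hmin hE]]]|ngF] := boolP (g < F).
  exists (weight R n); split; [exact: weight_gt0|by move/eqP: gF|move=> _].
  by exists h; split.
by exists 1%R; split.
Qed.

(* The points above [Node g] (or above [Minus g]) and below the next node of
   the branch fill an interval of length [l g], so that [Node g] starts at
   height [position g]: the values of [g] are exactly the indices of the weights
   of the steps taken below [g]. *)
Lemma road_below_interval F : exists I : set R,
  iso_interval [set u : X | trunk u <= F] I.
Proof.
have /choice[l lP] := step_length F.
have l0 g : (0 < l g)%R by have [] := lP g.
have lF : l F = 1%R by have [_ /(_ erefl)] := lP F.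
have lS g : g < F -> exists h, [/\ g < h, h <= F, forall k, k < h -> k <= g &
    position R h = (position R g + l g)%R] by have [_ _ h] := lP g.
have lin := ws_lin In_omega_well_stratified.
have lle g h : g < h -> h <= F -> (position R g + l g <= position R h)%R.
  move=> gh hF; have [k [gk kF kmin <-]] := lS _ (lt_le_trans gh hF).
  apply: position_le; have [//|] := lin F k h kF hF.
  rewrite le_eqVlt => /orP[/eqP->//|/kmin].
  by rewrite (lt_geF gh).
pose L (u : X) := match (road_val u).1 with
  | Node g => (position R g + (road_val u).2 * l g)%R
  | Minus g => position R (val g) end.
have Llt u v : trunk v <= F -> u < v -> (L u < L v)%R.
  move=> vF /road_ltE[|[g [eu ev r2]]]; last first.
    by rewrite /L eu ev ltrD2l ltr_pM2r.
  have /andP[_ u1] := road_val2 u; have /andP[v0 _] := road_val2 v.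
  have ul g : (position R g + (road_val u).2 * l g <= position R g + l g)%R.
    by rewrite lerD2l ler_piMl // ltW.
  move: vF; rewrite /trunk /L pad_ltE.
  case: (road_val u).1 (road_val v).1 => [g|g] [h|h] /= hF gh.
  - apply: le_lt_trans (ul g) _; apply: le_lt_trans (lle _ _ gh hF) _.
    by rewrite ltrDl mulr_gt0.
  - apply: le_lt_trans (ul g) _.
    have [k [gk kF kmin <-]] := lS _ (lt_le_trans gh hF).
    (* As [val h] has no predecessor, the node [k] following [g] is still strictly below it, and so
       is the end of the step of [g]. *)
    have nph : ~ has_pred (val h).
      apply/(on_zero_or_limit_levelP In_omega_well_stratified)/asboolP.
      by case: (h).
    apply: position_lt; rewrite lt_neqAle; apply/andP; split.
      by apply/eqP => e; apply: nph; have <- : k = val h by []; exists g.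
    have [//|] := lin F k (val h) kF hF.
    rewrite le_eqVlt => /orP[/eqP->//|/kmin].
    by rewrite (lt_geF gh).
  - apply: le_lt_trans (position_le R gh) _.
    by rewrite ltrDl mulr_gt0.
  - exact: position_lt.
have Lle u v : trunk u <= F -> trunk v <= F -> (L u <= L v)%R = (u <= v).
  move=> uF vF; apply/idP/idP => [|uv].
    apply: contraTT => nuv; rewrite -ltNge; apply: Llt => //.
    have [w wtop] := road_top F.
    have uw : u <= w by rewrite wtop.
    have vw : v <= w by rewrite wtop.
    have [uv|vu] := road_In_omega_lin uw vw; first by rewrite uv in nuv.
    rewrite lt_neqAle vu andbT; apply/eqP => e; move: nuv.
    by rewrite e lexx.
  move: uv; rewrite le_eqVlt => /orP[/eqP->//|uv].
  by apply/ltW/Llt.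
(* The left end is the height of the root; the right end is that of the last point over [Node F],
   since [l F = 1]. *)
exists [set r | (0 <= r <= position R F + 1)%R]; split.
  move=> x y /= /andP[x0 _] /andP[_ y1] z /andP[xz zy].
  by rewrite (le_trans x0 xz) (le_trans zy y1).
apply/order_isoP; exists L; split.
- move=> u /= uF; apply/andP; split.
    rewrite /L; case: (road_val u).1 => [g|g]; last exact: position_ge0.
    rewrite addr_ge0 ?position_ge0 // mulr_ge0 ?(ltW (l0 _)) //.
    by have /andP[/ltW] := road_val2 u.
  have [w wE] := road_point1 R (Node F).
  have -> : (position R F + 1)%R = L w by rewrite /L wE /= lF mulr1.
  rewrite Lle //; last by rewrite /trunk wE.
  rewrite road_leE wE /=; have /andP[_ ->] := road_val2 u.
  by rewrite implybT andbT; move: uF; rewrite /trunk; case: (road_val u).1.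
- move=> r /= /andP[r0 r1].
  (* Surjectivity: take the first node [g] whose step ends at or above [r]. Either [r] is above
     [position g] and is hit over [Node g], or [r] is hit by [Minus g]. *)
  pose S := [set g | g <= F /\ (r <= position R g + l g)%R].
  have [||g [gF rg] gmin] := wo_min (@In_omega_well_stratified F) (S := S).
  + by move=> g [].
  + by exists F; split; rewrite ?lexx ?lF.
  have below h : h < g -> (position R h + l h < r)%R.
    move=> hg; rewrite ltNge; apply/negP => rh.
    suff : g <= h by rewrite (lt_geF hg).
    apply: gmin; split=> //; exact: le_trans (ltW hg) gF.
  have [gr|rg'] := ltP (position R g) r.
    have [|u uE] := @road_Node g ((r - position R g) / l g)%R.
      by rewrite divr_gt0 ?subr_gt0 // ler_pdivrMr // mul1r lerBlDl.
    exists u; first by rewrite /trunk uE.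
    by rewrite /L uE /= divfK ?gt_eqF // addrC subrK.
  (* With a predecessor [m], the step of [m] would end exactly at [position g], hence at or above
     [r], against minimality of [g]. *)
  have npg : ~ has_pred g.
    move=> [m mg mmax]; have [h [mh hF hmin he]] := lS _ (lt_le_trans mg gF).
    have hg : h = g.
      have [] := lin F h g hF gF; rewrite le_eqVlt => /orP[/eqP//|].
        by move=> /mmax; rewrite (lt_geF mh).
      by move=> /hmin; rewrite (lt_geF mg).
    by have := below _ mg; rewrite -he hg ltNge rg'.
  (* If [r] were smaller, continuity would give an earlier [h] starting above [r], again against
     minimality. *)
  have rE : r = position R g.
    apply/le_anti; rewrite rg' /= leNgt; apply/negP => rg2.
    have [|h hg rh] := @position_limit R g r npg; first by rewrite r0.
    have := lt_trans (below _ hg) rh.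
    by rewrite ltNge lerDl ltW.
  have hg : `[< on_zero_or_limit_level g >].
    by apply/asboolP/(on_zero_or_limit_levelP In_omega_well_stratified).
  have [u uE] := road_point1 R (Minus (exist _ g hg)).
  by exists u; rewrite /trunk /L uE.
- move=> u v uF vF Luv; apply/le_anti.
  by rewrite -!Lle // Luv lexx.
- by move=> u v uF vF; rewrite Lle.
Qed.

Lemma road_branchwise_real : branchwise_real R X.
Proof.
split; first exact: road_tree_order.
  by move=> B /road_branch[F ->]; apply: road_below_interval.
by apply/road_infimums/pad_infimums/In_omega_infimums.
Qed.

End RoadInOmega.

(** * Cardinality of the road, and absence of gradings *)

Section Cardinality.
Implicit Types (f g : In_omega) (m n : nat).

(** Codes [f] by a relation on the naturals, so that there are at most continuum many nodes. The
    diagonal records which numbers are values. *)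
Definition value_order f m n : Prop := exists b c,
  [/\ graph f (b, m), graph f (c, n) & ordtype_le b c].

(** Induction on the argument [b]. The value [n] of [f] at [b] is taken by [g] at some [c]; since
    [f] is contained in [g] below [b], [c] cannot come earlier, and comparing [n] with the value of
    [g] at [b] settles the case where it comes later. *)
Lemma value_order_sub f g :
  (forall m n, value_order f m n <-> value_order g m n) -> f <= g.
Proof.
move=> fg; apply/In_omega_leP => -[b n].
elim/(@ordtype_ind nat): b n => b ih n fbn.
have /fg[c [_ [gcn _ _]]] : value_order f n n.
  by exists b, b; split=> //; apply/asboolP; left.
have [->//|bc|cb] := ordtype_total b c.
  have /lenP[m gbm] := ordtype_lt_trans bc (graph_len gcn).
  have /fg[b' [b'' [fb'm fb''n lb]]] : value_order g m n.
    by exists b, c; split=> //; apply: ordtype_ltW.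
  move: lb; rewrite (graph_inj fb''n fbn) => /asboolP[b'b|b'b].
    by subst b'; rewrite -(graph_fun fb'm fbn).
  have := graph_inj (ih _ b'b _ fb'm) gbm => e.
  by move: b'b; rewrite e => /ordtype_lt_irrefl.
have /lenP[m fcm] := ordtype_lt_trans cb (graph_len fbn).
have mn := graph_fun (ih _ cb _ fcm) gcn; subst m.
by move: cb; rewrite (graph_inj fcm fbn) => /ordtype_lt_irrefl.
Qed.

Lemma value_order_inj f g :
  (forall m n, value_order f m n <-> value_order g m n) -> f = g.
Proof.
move=> fg; apply/le_anti/andP; split; apply: value_order_sub => // m n.
by rewrite fg.
Qed.

Lemma card_le_continuum (T : Type) (K : countType) (e : T -> K -> bool) :
  (forall x y, e x =1 e y -> x = y) -> [set: T] #<= [set: continuum].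
Proof.
move=> einj.
pose F x n := if unpickle n is Some k then e x k else false.
apply: (card_le_inj (f := F : T -> continuum)) => // x y _ _ Fxy.
by apply: einj => k; have := congr1 (@^~ (pickle k)) Fxy; rewrite /F pickleK.
Qed.

Lemma card_le_road_continuum (R : realType) :
  [set: road R (pad In_omega)] #<= [set: continuum].
Proof.
(* A point is coded by countably many bits: the kind of its node, the value order of its trunk, and
   the rational cut of its height. *)
pose e (u : road R (pad In_omega)) (k : unit + (nat * nat + rat)) : bool :=
  match k with
  | inl _ => if (road_val u).1 is Node _ then true else false
  | inr (inl p) => `[< value_order (trunk u) p.1 p.2 >]
  | inr (inr q) => (ratr q < (road_val u).2)%R
  end.
apply: (@card_le_continuum _ _ e) => u v euv; apply: val_inj => /=.
have etrunk : trunk u = trunk v.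
  apply: value_order_inj => m n.
  have /= h := euv (inr (inl (m, n))).
  by split=> /asboolP; [rewrite h|rewrite -h] => /asboolP.
have ekind := euv (inl tt).
have e2 : (road_val u).2 = (road_val v).2.
  wlog uv : u v euv etrunk ekind / ((road_val u).2 < (road_val v).2)%R.
    move=> wl; have [uv|vu|//] := ltgtP (road_val u).2 (road_val v).2.
      exact: wl.
    by apply/esym; apply: wl => // k; rewrite euv.
  have [q] := rat_in_itvoo uv; rewrite in_itv /= => /andP[uq qv].
  by have /= := euv (inr (inr q)); rewrite qv (lt_gtF uq).
move: etrunk ekind e2; rewrite /trunk /e /=.
case: (road_val u) (road_val v) => [[g|g] t] [[h|h] s] //= gh _ ->.
  by rewrite gh.
by rewrite (val_inj gh).
Qed.

End Cardinality.

(** * Absence of continuous gradings *)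

Section NoGrading.
Implicit Types (f g : In_omega).

(* If [v] existed, then transfinite recursion along [f b := v (restr f b)] would
   never stop, hence would inject [ordtype nat] into [nat]. *)
Lemma In_omega_not_special (v : In_omega -> nat) :
  ~ forall f g, f < g -> v f <> v g.
Proof.
move=> vlt.
pose good f := forall b n, graph f (b, n) -> n = v (restr f b).
have agree f g b : good f -> good g -> ordtype_lt b (len f) ->
    ordtype_lt b (len g) -> restr f b = restr g b.
  move=> gf gg; elim/(@ordtype_ind nat): b => b ih bf bg.
  apply/val_inj; rewrite /= !graph_restr; apply/seteqP.
  have half f' g' : good f' -> good g' -> ordtype_lt b (len g') ->
      (forall c, ordtype_lt c b -> restr f' c = restr g' c) ->
      [set p | graph f' p /\ ordtype_lt p.1 b] `<=`
      [set p | graph g' p /\ ordtype_lt p.1 b].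
    move=> gf' gg' bg' e [c n] [/= fcn cb]; split=> //=.
    have /lenP[m gcm] := ordtype_lt_trans cb bg'.
    by rewrite (gf' _ _ fcn) e // -(gg' _ _ gcm).
  have ih' c : ordtype_lt c b -> restr f c = restr g c.
    by move=> cb; apply: ih => //; apply: ordtype_lt_trans cb _.
  by split; apply: half => // c /ih'.
have func f g b m n : good f -> good g -> graph f (b, m) -> graph g (b, n) ->
    m = n.
  move=> gf gg fm gn; rewrite (gf _ _ fm) (gg _ _ gn).
  by rewrite (agree f g) //; [apply: graph_len fm|apply: graph_len gn].
have inj f g b c n : good f -> good g -> ordtype_le b c -> graph f (b, n) ->
    graph g (c, n) -> b = c.
  move=> gf gg bc fb gc.
  have /lenP[m gb] := ordtype_le_lt_trans bc (graph_len gc).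
  by apply: graph_inj gc; rewrite (func f g b n m).
(* Good functions agree on common arguments and are jointly injective, so their union [F] is a node,
   the largest good one. *)
have [|||F FG] := @In_omega_mk (\bigcup_(f in good) graph f).
- move=> b c n [f gf /graph_len bf] cb.
  by have /lenP[m cm] := ordtype_lt_trans cb bf; exists m, f.
- by move=> b m n [f gf fm] [g gg gn]; exact: func fm gn.
- move=> b c n [f gf fb] [g gg gc].
  have [//|/ordtype_ltW bc|/ordtype_ltW cb] := ordtype_total b c.
    exact: inj bc fb gc.
  by apply/esym; exact: inj cb gc fb.
have gF : good F.
  move=> b n; rewrite FG => -[f gf fbn]; rewrite (gf _ _ fbn); congr v.
  have fF : f <= F by apply/In_omega_leP; rewrite FG => p fp; exists f.
  apply/le_anti/andP; split; apply/In_omega_leP; rewrite !graph_restr.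
    by move=> p [/(In_omega_leP f F).1] - /(_ fF).
  move=> [c m] [/= Fcm cb]; split=> //.
  have /lenP[k fck] := ordtype_lt_trans cb (graph_len fbn).
  by rewrite (graph_fun Fcm (graph_le fF fck)).
(* [v F] is fresh: each value of [F] is [v] of a proper restriction of [F]. Adjoining it gives a
   good [H], which must be contained in [F], a contradiction. *)
have [|H HG] := @In_omega_snoc F (v F).
  move=> b Fb; apply: (vlt (restr F b) F); first exact/restr_lt/graph_len/Fb.
  by rewrite -(gF _ _ Fb).
have FH : F <= H by apply/In_omega_leP; rewrite HG; left.
have restrH b : ordtype_le b (len F) -> restr H b = restr F b.
  move=> bF; apply/val_inj; rewrite /= !graph_restr HG; apply/seteqP; split.
    move=> [c n] [[/= Fcn|[-> _]] cb]; first by [].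
    by move/ordtype_leP: bF.
  by move=> p [Fp pb]; split=> //; left.
have gH : good H.
  move=> b n; rewrite HG => -[Fbn|[-> ->]].
    by rewrite restrH ?(gF _ _ Fbn) //; apply/ordtype_ltW/graph_len/Fbn.
  rewrite restrH; last by apply/asboolP; left.
  congr v; apply/val_inj; rewrite /= graph_restr; apply/seteqP.
  split=> [[c m] Fcm|p []//]; split=> //; exact: graph_len Fcm.
have : graph F (len F, v F) by rewrite FG; exists H => //; rewrite HG; right.
by move=> /graph_len /ordtype_lt_irrefl.
Qed.

(** A rational is picked between the grades at heights 1/2 and 1 over [Node f]. When [f < g], the
    upper point over [f] precedes the lower one over [g], so the rationals differ and their codes
    contradict [In_omega_not_special]. *)
Lemma road_not_graded (R : realType) :
  ~ exists l : road R (pad In_omega) -> R, continuous_grading l.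
Proof.
move=> [l [lmono _]].
have half01 : (0 < 2^-1 :> R)%R /\ (2^-1 < 1 :> R)%R.
  by rewrite invr_gt0 invf_lt1 ?ltr0n ?ltr1n.
have [h0 h1] := half01.
have /choice[q qP] : forall f, exists q : rat, exists u w : road R (pad In_omega),
    [/\ road_val u = (Node f, 2^-1)%R, road_val w = (Node f, 1%R) &
        (l u < ratr q < l w)%R].
  move=> f; have [|u uE] := @road_Node R f (2^-1)%R; first by rewrite h0 ltW.
  have [w wE] := road_point1 R (Node f).
  have uw : u < w.
    rewrite lt_neqAle road_le2 uE wE //= ltW // andbT; apply/eqP => e.
    by move: h1; have := congr1 snd wE; rewrite -e uE /= => ->; rewrite ltxx.
  have [q] := rat_in_itvoo (lmono _ _ uw); rewrite in_itv /= => uqw.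
  by exists q, u, w.
apply: (@In_omega_not_special (pickle \o q)) => f g fg /= /(pcan_inj pickleK) e.
have [u [w [_ wE /andP[_ qw]]]] := qP f; have [u' [w' [uE _ /andP[uq _]]]] := qP g.
have wu : w < u' by apply: road_lt1; rewrite wE uE /= pad_ltE.
have := lt_trans qw (lt_trans (lmono _ _ wu) uq).
by rewrite e ltxx.
Qed.

End NoGrading.

Theorem theorem5p13 (R : realType) :
  let X := road R (pad In_omega) in
  [/\ branchwise_real R X,
      wispy R X (card_succ continuum) &
      CH ->
      exists (d : Order.disp_t) (Y : porderType d),
        [/\ branchwise_real R Y,
            wispy R Y (aleph 2) &
            ~ exists l : Y -> R, continuous_grading l]].
Proof.
move=> X; split; first exact: road_branchwise_real.
  apply: tree_order_wispy; [exact: road_tree_order|].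
  exact: card_le_road_continuum.
move=> ch; exists _, X; split; first exact: road_branchwise_real.
  (* [aleph 2] unfolds to [card_succ (aleph 1)], so it suffices that [CH] bounds the continuum by
     [aleph 1]. *)
  apply: (@tree_order_wispy _ _ _ (aleph 1)); first exact: road_tree_order.
  apply: card_le_trans (card_le_road_continuum R) _.
  by move: ch; rewrite /CH card_eq_le => /andP[].
exact: road_not_graded.
Qed.
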